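(* Let $k\in\mathbb N$, $k\ge2$, and let $(E,\|\cdot\|_E)$ be a symmetric space with the Fatou property. If $E^d$ is compactly fully $k$-rotund and locally uniformly rotund, and $E$ has an equivalent symmetric norm $\|\cdot\|_o$ that is compactly fully $k$-rotund, then $E$ (with the norm $\|\cdot\|_E$) is compactly fully $k$-rotund.
   Context: Let $I=[0,\alpha)$, $\alpha=1$ or $\alpha=\infty$, with Lebesgue measure $\mu$, and $L^0$ the set of (classes of) extended real valued measurable functions on $I$. A Banach function space $(E,\|\cdot\|_E)$ is a Banach lattice that is a sublattice of $L^0$ such that (1) if $x\in L^0$, $y\in E$, $|x|\le|y|$ a.e., then $x\in E$ and $\|x\|_E\le\|y\|_E$; (2) there is a strictly positive $x\in E$. $E^+=\{x\in E:x\ge0\}$; $S_E$ is the unit sphere. Fatou property: if $(x_n)\subset E^+$, $\sup_n\|x_n\|_E<\infty$ and $x_n\uparrow x\in L^0$, then $x\in E$ and $\|x_n\|_E\uparrow\|x\|_E$. For $x\in L^0$: $d_x(\lambda)=\mu\{s\in I:|x(s)|>\lambda\}$, $x^*(t)=\inf\{\lambda>0:d_x(\lambda)\le t\}$. A symmetric space is a Banach function space $E$ such that $x\in L^0$, $y\in E$, $d_x=d_y$ imply $x\in E$ and $\|x\|_E=\|y\|_E$; its norm is called symmetric. $E^d=\{x^*:x\in E\}$ (the cone of nonnegative decreasing elements). A property holds on $E^d$ if its definition holds when only elements of $E^d$ are considered. A Banach space $X$ (or its norm) is compactly fully $k$-rotund if every sequence $(x_n)\subset S_X$ such that $\|\sum_{i=1}^k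 x_{n,i}\|_X\to k$ as $n\to\infty$ for any $k$ subsequences $(x_{n,1})_n,\dots,(x_{n,k})_n$ of $(x_n)$ forms a relatively compact set; $E^d$ is compactly fully $k$-rotund if this holds for sequences $(x_n)\subset S_E\cap E^d$. $E^d$ is locally uniformly rotund if for every $x\in E^d$ and every $(x_n)\subset E^d$ with $\|x_n+x\|_E\to2\|x\|_E$ and $\|x_n\|_E\to\|x\|_E$ one has $\|x_n-x\|_E\to0$. *)

(* Defs.v *)
From HB Require Import structures.
From mathcomp Require Import all_boot all_order all_algebra.
From mathcomp Require Import all_classical all_reals all_analysis.
From mathcomp Require Import measurable_realfun.

Set Implicit Arguments.
Unset Strict Implicit.
Unset Printing Implicit Defensive.

Import Order.TTheory GRing.Theory Num.Theory.
Import numFieldNormedType.Exports.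

Local Open Scope classical_set_scope.
Local Open Scope ring_scope.

Section FunctionSpaces.
Context {R : realType}.
Implicit Types (alpha : \bar R) (f g : R -> \bar R).

Definition dom alpha : set R := [set t | 0 <= t /\ (t%:E < alpha)%E].

Definition ae_on alpha (P : R -> Prop) : Prop :=
  {ae (@lebesgue_measure R), forall t, dom alpha t -> P t}.

(* The elements of L^0 are represented by functions on R, of which only the
   values on [0, alpha) matter, up to [ae_on]-equality. Every class of Lebesgue
   measurable functions has a Borel measurable member, so the library's Borel
   sigma-algebra yields the same classes. *)
Definition L0 alpha : set (R -> \bar R) :=
  [set f : R -> \bar R | measurable_fun (dom alpha) f].

Definition aeq alpha f g : Prop := ae_on alpha (fun t => f t = g t).

Definition distribution_fun alpha f (l : R) : \bar R :=
  @lebesgue_measure R [set s | dom alpha s /\ (l%:E < `|f s|)%E].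

Definition rearrangement alpha f (t : R) : \bar R :=
  ereal_inf [set l%:E | l in
    [set l : R | 0 < l /\ (distribution_fun alpha f l <= t%:E)%E]].

(* A Banach space with a linear, injective (modulo a.e. equality) embedding
   [bfs_fun] into L^0. Since addition is only partially defined on extended
   reals, being a vector space forces elements to be a.e. finite. *)
Record banach_function_space alpha := BanachFunctionSpace {
  bfs_sort :> completeNormedModType R ;
  bfs_fun : bfs_sort -> R -> \bar R ;
  bfs_L0 : forall x, L0 alpha (bfs_fun x) ;
  bfs_fin : forall x, ae_on alpha (fun t => bfs_fun x t \is a fin_num) ;
  bfs_inj : forall x y, aeq alpha (bfs_fun x) (bfs_fun y) -> x = y ;
  bfs_add : forall x y,
    aeq alpha (bfs_fun (x + y)) (fun t => bfs_fun x t + bfs_fun y t)%E ;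
  bfs_scale : forall (a : R) x,
    aeq alpha (bfs_fun (a *: x)) (fun t => a%:E * bfs_fun x t)%E ;
  bfs_sup : forall x y, exists z,
    aeq alpha (bfs_fun z) (fun t => maxe (bfs_fun x t) (bfs_fun y t)) ;
  bfs_inf : forall x y, exists z,
    aeq alpha (bfs_fun z) (fun t => mine (bfs_fun x t) (bfs_fun y t)) ;
  bfs_ideal : forall f y, L0 alpha f ->
    ae_on alpha (fun t => (`|f t| <= `|bfs_fun y t|)%E) ->
    exists x, aeq alpha (bfs_fun x) f /\ `|x| <= `|y| ;
  bfs_pos : exists x, ae_on alpha (fun t => (0 < bfs_fun x t)%E)
}.

Definition fatou_property alpha (E : banach_function_space alpha) : Prop :=
  forall (x : nat -> E) f,
    (forall n, ae_on alpha (fun t => (0 <= bfs_fun (x n) t)%E)) ->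
    (exists M : R, forall n, `|x n| <= M) ->
    L0 alpha f ->
    (forall n, ae_on alpha (fun t => (bfs_fun (x n) t <= bfs_fun (x n.+1) t)%E)) ->
    ae_on alpha (fun t => (fun n => bfs_fun (x n) t) @ \oo --> f t) ->
    exists y : E, [/\ aeq alpha (bfs_fun y) f,
      nondecreasing_seq (fun n => `|x n|) &
      (fun n => `|x n|) @ \oo --> `|y|].

Definition symmetric_space alpha (E : banach_function_space alpha) : Prop :=
  forall f (y : E), L0 alpha f ->
    distribution_fun alpha f = distribution_fun alpha (bfs_fun y) ->
    exists x : E, aeq alpha (bfs_fun x) f /\ `|x| = `|y|.

Definition decreasing_cone alpha (E : banach_function_space alpha) : set E :=
  [set y | exists x : E,
    aeq alpha (bfs_fun y) (rearrangement alpha (bfs_fun x))].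

(* [F] is [E] endowed with an equivalent norm: both embed onto the same subset
   of L^0, and their norms are equivalent there. *)
Definition equivalent_renorming alpha (E F : banach_function_space alpha) :
    Prop :=
  [/\ forall x : E, exists y : F, aeq alpha (bfs_fun y) (bfs_fun x),
      forall y : F, exists x : E, aeq alpha (bfs_fun x) (bfs_fun y) &
      exists c C : R, [/\ 0 < c, 0 < C &
        forall (x : E) (y : F), aeq alpha (bfs_fun x) (bfs_fun y) ->
          c * `|x| <= `|y| /\ `|y| <= C * `|x|]].

End FunctionSpaces.

Arguments decreasing_cone {R alpha} E.

Section Rotundity.
Context {R : realType} {X : normedModType R}.

Definition compactly_fully_rotund_on (k : nat) (A : set X) : Prop :=
  forall x : nat -> X,
    (forall n, A (x n)) ->
    (forall n, `|x n| = 1) ->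
    (forall phi : 'I_k -> nat -> nat,
      (forall i, {homo phi i : m n / (m < n)%N}) ->
      (fun n => `|\sum_(i < k) x (phi i n)|) @ \oo --> (k%:R : R)) ->
    precompact (range x).

Definition locally_uniformly_rotund_on (A : set X) : Prop :=
  forall (x : X) (y : nat -> X),
    A x ->
    (forall n, A (y n)) ->
    (fun n => `|y n + x|) @ \oo --> 2 * `|x| ->
    (fun n => `|y n|) @ \oo --> `|x| ->
    (fun n => `|y n - x|) @ \oo --> (0 : R).

End Rotundity.

Definition compactly_fully_rotund (R : realType) (k : nat)
    (X : normedModType R) : Prop :=
  compactly_fully_rotund_on k [set: X].

(* Main.v *)
Require Import Defs.
From HB Require Import structures.
From mathcomp Require Import all_boot all_order all_algebra perm.
From mathcomp Require Import all_classical all_reals all_analysis.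
From mathcomp Require Import measurable_realfun ring lra.

(* Write x* for the decreasing rearrangement of x. A symmetric norm with the Fatou
   property satisfies ||sum_i x_i|| <= ||sum_i x_i*||. After replacing the x_i by
   simple functions that are constant on finitely many cells of equal measure,
   this follows from two-point rearrangements: if every x_i is modified so that,
   of its values on two given cells, it takes the larger one on the first cell,
   then the old sum is a convex combination of the new sum and of its image under
   the transposition of the two cells.

   Hence if ||x_{n,1} + ... + x_{n,k}||_E -> k for all choices of subsequences,
   the same is true of the sequence of the x_n*, which therefore has a limit z in
   E^d along a subsequence. Along it, put S_n = x_{n,1} + ... + x_{n,k}; the
   inequality above, applied to the k + 1 functions x_{n,1}, ..., x_{n,k}, S_n,
   gives 2 ||S_n|| <= ||x_{n,1}* + ... + x_{n,k}* + S_n*||, so that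
   ||S_n* + k z|| -> 2 k, and S_n* -> k z by local uniform rotundity. As
   ||.||_o is symmetric, ||S_n||_o -> k ||z||_o and ||x_n||_o -> ||z||_o, so the
   compact full k-rotundity of ||.||_o applies to x_n / ||x_n||_o. *)

Set Implicit Arguments.
Unset Strict Implicit.
Unset Printing Implicit Defensive.

Import Order.TTheory GRing.Theory Num.Theory.
Import numFieldNormedType.Exports.

Local Open Scope classical_set_scope.
Local Open Scope ring_scope.

(** * Precompact ranges of sequences and convergent subsequences *)

Section SequentialCompactness.
Context {R : realType}.

Lemma homo_ltn_ge (phi : nat -> nat) :
  {homo phi : m n / (m < n)%N} -> forall n, (n <= phi n)%N.
Proof.
move=> h; elim=> // n ih; exact: leq_ltn_trans ih (h _ _ (ltnSn n)).
Qed.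

Lemma homo_ltn_cvg_infty (phi : nat -> nat) :
  {homo phi : m n / (m < n)%N} -> phi @ \oo --> \oo.
Proof.
move=> h A [N _ NA]; exists N => // n /= Nn.
by apply: NA => /=; exact: leq_trans Nn (homo_ltn_ge h n).
Qed.

Lemma cvg_subseq (T : topologicalType) (x : nat -> T) (z : T) (phi : nat -> nat) :
  {homo phi : m n / (m < n)%N} -> x @ \oo --> z -> x \o phi @ \oo --> z.
Proof. by move=> h xz; apply: cvg_comp xz; exact: homo_ltn_cvg_infty. Qed.

(** Dependent choice: the condition on the next index may involve the stage [j] and the index chosen
    just before. *)
Lemma subseq_rec (P : nat -> nat -> nat -> Prop) :
  (forall j N, exists n, (N < n)%N /\ P j N n) ->
  exists2 phi : nat -> nat,
    {homo phi : m n / (m < n)%N} & forall j, P j (phi j) (phi j.+1).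
Proof.
move=> h.
have /choice[f fP] : forall jN : nat * nat,
    exists n, (jN.2 < n)%N /\ P jN.1 jN.2 n by move=> [j N]; exact: h.
pose phi := fix phi j := if j is j'.+1 then f (j', phi j') else 0%N.
exists phi.
  apply: homo_ltn => [|j]; first exact: ltn_trans.
  by have [+ _] := fP (j, phi j).
by move=> j; have [] := fP (j, phi j).
Qed.

(** Compactness of the closure gives a cluster point [z]; indices with [x n] within [1/(j+1)] of [z]
    are then chosen recursively. *)
Lemma precompact_range_subseq (X : normedModType R) (x : nat -> X) :
  precompact (range x) ->
  exists2 phi : nat -> nat, {homo phi : m n / (m < n)%N} &
    exists z : X, x \o phi @ \oo --> z.
Proof.
rewrite precompactE => /(_ (x @ \oo) _)[|z [_ zx]].
  by exists 0%N => // n _; apply: subset_closure; exists n.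
have [j N|phi homphi phiP] := @subseq_rec
    (fun j _ n => `|z - x n| < j.+1%:R^-1).
  have xN : (x @ \oo) [set x n | n in [set n | (N < n)%N]].
    by exists N.+1 => // n Nn /=; exists n.
  have zN : nbhs z (ball z j.+1%:R^-1) by apply: nbhsx_ballx; rewrite invr_gt0.
  have [_ [[n Nn <-] zn]] := zx _ _ xN zN.
  by exists n; split => //; move: zn; rewrite -ball_normE.
(* The estimate of stage [j] concerns [phi j.+1], hence the shift by one. *)
exists (phi \o succn) => [m n mn|]; first exact: homphi.
exists z; apply/cvgrPdist_lt => e e0.
near=> n; apply: (lt_trans (phiP n)).
near: n; exact: (near_infty_natSinv_lt (PosNum e0)).
Unshelve. all: by end_near. Qed.

(** By completeness it suffices that every ultrafilter [F] containing the closure of the range is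
    Cauchy. If no ball of radius [e] belongs to [F], there is always a further term at distance at
    least [e / 2] from all terms up to a given index, and a subsequence of such terms has no
    convergent subsequence. *)
Lemma subseq_precompact_range (X : completeNormedModType R) (x : nat -> X) :
  (forall phi : nat -> nat, {homo phi : m n / (m < n)%N} ->
    exists2 psi : nat -> nat, {homo psi : m n / (m < n)%N} &
    exists z : X, x \o phi \o psi @ \oo --> z) ->
  precompact (range x).
Proof.
move=> h; rewrite precompactE compact_ultra => F UF Fx.
suff Fc : cauchy F.
  have Fcvg : F --> lim F by exact: cauchy_cvg.
  exists (lim F); split => //.
  have cl : closed (closure (range x)) by exact: closed_closure.
  by apply: cl => B /Fcvg FB; exact: filter_ex (filterI Fx FB).
apply: cauchy_exP => e e0; apply: contrapT => nF.
have nF' y : F (~` ball y e).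
  have [Fy|//] := in_ultra_setVsetC (ball y e) UF.
  by exfalso; apply: nF; exists y.
have e20 : 0 < e / 2 by rewrite divr_gt0.
have sep N : exists m, (N < m)%N /\
    forall i, (i < N.+1)%N -> e / 2 <= `|x m - x i|.
  (* A point of the closure outside finitely many balls of radius [e] is approximated by some [x m]
     up to [e / 2], which leaves [e / 2] as separation. *)
  have : F (closure (range x) `&`
      [set w | forall i, (i < N.+1)%N -> (~` ball (x i) e) w]).
    apply: filterI => //; elim: N.+1 => [|n ih].
      by apply: filterS filterT.
    apply: filterS (filterI ih (nF' (x n))) => w [w1 w2] i.
    by rewrite ltnS leq_eqVlt => /orP[/eqP->|]; [exact: w2|exact: w1].
  move=> /filter_ex[w [cw wi]].
  have [_ [[m _ <-] mw]] := cw _ (nbhsx_ballx w _ e20).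
  have sepm i : (i < N.+1)%N -> e / 2 <= `|x m - x i|.
    move=> /wi; rewrite -ball_normE /= => /negP; rewrite -leNgt => d1.
    move: mw; rewrite -ball_normE /= => d2.
    have := ler_distD (x m) (x i) w; rewrite (distrC w) in d2.
    rewrite (distrC (x m) (x i)); lra.
  (* An index [m <= N] would be separated from itself. *)
  exists m; split => //; rewrite ltnNge; apply/negP => mN.
  by have := sepm m mN; rewrite subrr normr0 leNgt e20.
have [//|phi homphi phiP] := @subseq_rec
    (fun _ N m => forall i, (i < N.+1)%N -> e / 2 <= `|x m - x i|).
have [psi hompsi [z /cvgrPdist_lt xz]] := h _ homphi.
have [N _ NP] := xz _ (divr_gt0 e20 (ltr0n R 2)).
have lt01 : (psi N < psi N.+1)%N by exact: hompsi.
have d1 := NP N (leqnn N); have d2 := NP N.+1 (leqnSn N).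
(* Being larger than [psi N], the index [psi N.+1] is a successor [j.+1], and [phiP j] separates
   [x (phi j.+1)] from all terms of index up to [phi j], among them [x (phi (psi N))]. *)
case Ej : (psi N.+1) lt01 => [//|j] jN.
have := phiP j (phi (psi N)); rewrite ltnS.
have -> : (phi (psi N) <= phi j)%N.
  by move: jN; rewrite ltnS leq_eqVlt => /orP[/eqP->|/homphi/ltnW].
move=> /(_ isT); have := ler_distD z (x (phi j.+1)) (x (phi (psi N))).
move: d1 d2; rewrite /= Ej (distrC (x (phi j.+1)) z); lra.
Qed.

End SequentialCompactness.

(** * Two-point rearrangements of finite families *)

Section Sorting.
Context {R : realFieldType} (I : finType) (N : nat).
Implicit Types (u v w : 'I_N -> R) (B : ('I_N -> R) -> Prop).

(** Extremal argument: among the tuples of permutations for which [B] fails, take one with maximal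
    [Phi]. If some row is not decreasing, ordering two positions [a < b] in all rows at once
    increases [Phi], so [B] holds for the new sum. The old sum is a convex combination of the new
    one and its transpose, a contradiction. *)
Lemma perm_sorted_induction B (u : I -> 'I_N -> R) :
  (forall v (s : {perm 'I_N}), B v -> B (v \o s)) ->
  (forall v w a, 0 <= a <= 1 -> B v -> B w ->
    B (fun q => a * v q + (1 - a) * w q)) ->
  (forall s : I -> {perm 'I_N},
    (forall i (p q : 'I_N), (p <= q)%N -> u i (s i q) <= u i (s i p)) ->
    B (fun q => \sum_i u i (s i q))) ->
  B (fun q => \sum_i u i q).
Proof.
move=> Bperm Bconv Bsorted; apply: contrapT => nB.
pose S (s : {ffun I -> {perm 'I_N}}) q := \sum_i u i (s i q).
(* The weight [- q] decreases in [q], so moving a larger value to a smaller index increases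
   [Phi]. *)
pose Phi (s : {ffun I -> {perm 'I_N}}) :=
  \sum_i \sum_q u i (s i q) * - (q%:R : R).
pose s0 : {ffun I -> {perm 'I_N}} := [ffun=> 1%g].
have nB1 : `[< ~ B (S s0) >].
  apply/asboolP; suff -> : S s0 = (fun q => \sum_i u i q) by [].
  by apply/funext => q; apply: eq_bigr => i _; rewrite ffunE perm1.
case: (@Order.TotalTheory.arg_maxP _ R _ s0 (fun s => `[< ~ B (S s) >]) Phi nB1)
  => s /asboolP nBs smax.
apply: (nBs); apply: Bsorted => i0 a b ab; rewrite leNgt; apply/negP => lt_ab.
have ltab : (a < b)%N.
  by rewrite ltn_neqAle ab andbT; apply/eqP => /val_inj E; rewrite E ltxx in lt_ab.
have neqab : a != b by apply/eqP => E; rewrite E ltxx in lt_ab.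
(* Only the rows whose values at [a] and [b] are in the wrong order get transposed. *)
pose c i := u i (s i a) < u i (s i b).
pose s' : {ffun I -> {perm 'I_N}} :=
  [ffun i => if c i then (tperm a b * s i)%g else s i].
have s'E i q : u i (s' i q) = if c i then u i (s i (tperm a b q)) else u i (s i q).
  by rewrite ffunE; case: ifP => // _; rewrite permM.
have splitab (G : 'I_N -> R) :
    \sum_q G q = G a + G b + \sum_(q | (q != a) && (q != b)) G q.
  by rewrite (bigD1 a)//= (bigD1 b) ?addrA//= eq_sym.
have s'o i q : q != a -> q != b -> u i (s' i q) = u i (s i q).
  move=> qa qb; rewrite s'E; case: ifP => // _.
  by rewrite tpermD // eq_sym.
have s'a i : u i (s' i a) = Num.max (u i (s i a)) (u i (s i b)).
  by rewrite s'E /c tpermL maxEge; case: ltgtP => // ->.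
have s'b i : u i (s' i b) = Num.min (u i (s i a)) (u i (s i b)).
  by rewrite s'E /c tpermR minEge; case: ltgtP => // ->.
have ltPhi : Phi s < Phi s'.
  have ab' : (a%:R : R) < b%:R by rewrite ltr_nat.
  have PhiE i : \sum_q u i (s' i q) * - (q%:R : R) =
      \sum_q u i (s i q) * - (q%:R : R) +
      (Num.max (u i (s i a)) (u i (s i b)) - u i (s i a)) * (b%:R - a%:R).
    rewrite !splitab s'a s'b (eq_bigr (fun q => u i (s i q) * - (q%:R : R))).
      have := addr_max_min (u i (s i a)) (u i (s i b)).
      set M := Num.max _ _; set m := Num.min _ _ => Mm.
      have -> : m = u i (s i a) + u i (s i b) - M by rewrite -Mm; ring.
      ring.
    by move=> q /andP[qa qb]; rewrite s'o.
  rewrite /Phi (eq_bigr _ (fun i _ => PhiE i)) big_split /= ltrDl.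
  rewrite (bigD1 i0) //= ltr_pwDl //.
    by rewrite mulr_gt0 ?subr_gt0 // lt_max lt_ab orbT.
  by apply: sumr_ge0 => i _; rewrite mulr_ge0 ?subr_ge0 ?(ltW ab') // le_max lexx.
have /contrapT Bs' : ~ ~ B (S s').
  move=> nBs'; have /smax := asboolT nBs'.
  by rewrite /= leNgt ltPhi.
have Bt := Bperm _ (tperm a b) Bs'.
have Sab : S s' a + S s' b = S s a + S s b.
  rewrite /S -!big_split; apply: eq_bigr => i _ /=.
  by rewrite s'a s'b addr_max_min.
have Sa1 : S s a <= S s' a.
  by apply: ler_sum => i _; rewrite s'a le_max lexx.
have Sa2 : S s b <= S s' a.
  by apply: ler_sum => i _; rewrite s'a le_max lexx orbT.
have So q : q != a -> q != b -> S s' q = S s q.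
  by move=> qa qb; apply: eq_bigr => i _; exact: s'o.
apply: (nBs).
(* If the new sum agrees at [a] and [b], the old values there, bounded by the new maximum and with
   the same total, agree with it too. Otherwise the difference can be divided by. *)
have [E|nE] := eqVneq (S s' a) (S s' b).
  suff -> : S s = S s' by [].
  apply/funext => q; have [->|qa] := eqVneq q a; first lra.
  have [->|qb] := eqVneq q b; first lra.
  by rewrite So.
have gt0 : 0 < S s' a - S s' b.
  by rewrite lt_neqAle eq_sym subr_eq0 nE /=; lra.
(* [t] solves the equation at [a]; the one at [b] follows because both sums have the same total over
   [a] and [b]. *)
pose t := (S s a - S s' b) / (S s' a - S s' b).
have t01 : 0 <= t <= 1.
  by rewrite /t divr_ge0 ?(ltW gt0)//=; [rewrite ler_pdivrMr //; lra| lra].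
have := Bconv _ _ t t01 Bs' Bt.
suff <- : S s = (fun q => t * S s' q + (1 - t) * (S s' \o tperm a b) q) by [].
have tE : t * (S s' a - S s' b) = S s a - S s' b.
  by rewrite /t divfK // lt0r_neq0.
apply/funext => q /=; have [->|qa] := eqVneq q a.
  by rewrite tpermL; lra.
have [->|qb] := eqVneq q b; first by rewrite tpermR; lra.
by rewrite tpermD 1?eq_sym // So //; ring.
Qed.

End Sorting.

(** * Distribution functions and decreasing rearrangements *)

Section Rearrangement.
Context {R : realType} (alpha : \bar R).
Implicit Types (f g : R -> \bar R).
Local Notation D := (dom alpha).
Local Notation mu := (@lebesgue_measure R).
Local Notation dist := (distribution_fun alpha).

Local Instance lebesgue_ae_filter : Filter (almost_everywhere mu).
Proof. exact: (@ae_filter_ringOfSetsType _ _ R (@lebesgue_measure R)). Qed.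

Lemma ae_onW (P : R -> Prop) : (forall t, D t -> P t) -> ae_on alpha P.
Proof. by move=> h; apply: aeW. Qed.

Lemma ae_onS (P Q : R -> Prop) :
  (forall t, D t -> P t -> Q t) -> ae_on alpha P -> ae_on alpha Q.
Proof.
move=> h; rewrite /ae_on; apply: (@filterS _ _ lebesgue_ae_filter) => t hP Dt.
exact: h (hP Dt).
Qed.

Lemma ae_onS2 (P Q S : R -> Prop) : (forall t, D t -> P t -> Q t -> S t) ->
  ae_on alpha P -> ae_on alpha Q -> ae_on alpha S.
Proof.
move=> h; rewrite /ae_on; apply: (@filterS2 _ _ lebesgue_ae_filter) => t hP hQ Dt.
exact: h (hP Dt) (hQ Dt).
Qed.

Lemma ae_on_forall (P : nat -> R -> Prop) : (forall n, ae_on alpha (P n)) ->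
  ae_on alpha (fun t => forall n, P n t).
Proof.
move=> /(ae_foralln (mu := mu)).
by rewrite /ae_on; apply: (@filterS _ _ lebesgue_ae_filter) => t h Dt n; exact: h.
Qed.

Lemma measurable_dom (a : \bar R) : measurable (dom a).
Proof.
case: a => [a| |]; rewrite /dom.
- rewrite (_ : [set _ | _] = [set` `[0, a[]); first exact: measurable_itv.
  by apply/seteqP; split=> t /=; rewrite in_itv/= lte_fin; [case=> -> ->|case/andP].
- rewrite (_ : [set _ | _] = [set` `[0, +oo[]); first exact: measurable_itv.
  apply/seteqP; split=> t /=; rewrite in_itv/= ?andbT; first by case.
  by move=> ->; rewrite ltry.
- by rewrite (_ : [set _ | _] = set0) // -subset0 => t /= [_].
Qed.

Lemma lebesgue_measure_dom (a : \bar R) : (0 <= a)%E -> mu (dom a) = a.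
Proof.
case: a => [a| |]; rewrite /dom => a0 //.
- rewrite (_ : [set _ | _] = [set` `[0, a[]).
    rewrite lebesgue_measure_itv /= lte_fin; case: ltP => [_|a0']; first by rewrite sube0.
    by congr (_%:E); apply/le_anti; rewrite a0' -lee_fin a0.
  by apply/seteqP; split=> t /=; rewrite in_itv/= lte_fin; [case=> -> ->|case/andP].
- rewrite (_ : [set _ | _] = [set` `[0, +oo[]).
    by rewrite lebesgue_measure_itv /= ltry.
  apply/seteqP; split=> t /=; rewrite in_itv/= ?andbT; first by case.
  by move=> ->; rewrite ltry.
Qed.

(** If [alpha <= t], then [A] lies in [[0, t)] and has measure at most [t]. *)
Lemma dom_lt_measure (A : set R) t : measurable A -> A `<=` D ->
  0 <= t -> (t%:E < mu A)%E -> D t.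
Proof.
move=> mA AD t0 tA; split=> //; rewrite ltNge; apply/negP => alphat.
move: tA; apply/negP; rewrite -leNgt.
have At : A `<=` [set` `[0, t[].
  move=> s /AD[s0 sa] /=; rewrite in_itv/= s0 /= -lte_fin.
  exact: lt_le_trans sa alphat.
apply: (@le_trans _ _ (mu [set` `[0, t[])).
  by apply: le_measure; rewrite ?inE//; exact: measurable_itv.
by rewrite lebesgue_measure_itv /= lte_fin; case: ltP; rewrite ?sube0 // lee_fin.
Qed.

Lemma measurable_superlevel f l : L0 alpha f ->
  measurable [set s | D s /\ (l < `|f s|)%E].
Proof.
move=> mf; have mabs : measurable_fun D (abse \o f).
  by apply: measurableT_comp => //.
exact: (emeasurable_fun_o_infty (measurable_dom alpha) mabs l).
Qed.

Lemma distribution_fun_ge0 f l : (0 <= dist f l)%E.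
Proof. exact: measure_ge0. Qed.

Lemma distribution_fun_lt0 f g l : l < 0 -> dist f l = dist g l.
Proof.
move=> l0; rewrite /distribution_fun; congr mu; apply/seteqP.
by split=> s /= [Ds _]; split=> //; apply: lt_le_trans (abse_ge0 _);
  rewrite lte_fin.
Qed.

Lemma le_distribution_fun f g l : L0 alpha f -> L0 alpha g ->
  ae_on alpha (fun t => `|f t| <= `|g t|)%E -> (dist f l <= dist g l)%E.
Proof.
move=> mf mg [N [mN N0 Nfg]].
rewrite /distribution_fun.
have mF := measurable_superlevel l%:E mf; have mG := measurable_superlevel l%:E mg.
apply: (@le_trans _ _ (mu ([set s | D s /\ (l%:E < `|g s|)%E] `|` N))).
  apply: le_measure; rewrite ?inE//; first exact: measurableU.
  move=> s [Ds lf]; have [sN|sN] := pselect (N s); [by right|left; split=> //].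
  apply: lt_le_trans lf _; apply: contrapT => h; apply: sN; apply: Nfg => /= h'.
  exact: h (h' Ds).
have : (mu ([set s | D s /\ (l%:E < `|g s|)%E] `|` N) <=
    mu [set s | D s /\ (l%:E < `|g s|)%E] + mu N)%E by exact: measureU2.
by rewrite N0 adde0.
Qed.

Lemma aeq_sym f g : aeq alpha f g -> aeq alpha g f.
Proof. by apply: ae_onS => t Dt ->. Qed.

Lemma aeq_trans f g h : aeq alpha f g -> aeq alpha g h -> aeq alpha f h.
Proof. by apply: ae_onS2 => t Dt -> ->. Qed.

Lemma distribution_fun_aeq f g : L0 alpha f -> L0 alpha g -> aeq alpha f g ->
  dist f = dist g.
Proof.
move=> mf mg fg; apply/funext => l; apply/eqP; rewrite eq_le.
by rewrite !le_distribution_fun //; apply: ae_onS fg => t Dt ->.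
Qed.

Lemma nonincreasing_distribution_fun f l l' : L0 alpha f ->
  l <= l' -> (dist f l' <= dist f l)%E.
Proof.
move=> mf ll'; apply: le_measure; rewrite ?inE;
  do ?exact: measurable_superlevel.
by move=> s [Ds h]; split=> //; apply: le_lt_trans h; rewrite lee_fin.
Qed.

(** Continuity of the measure from below: the superlevel sets at [l + 1/(n+1)] increase to the one
    at [l]. *)
Lemma distribution_fun_right_continuous f l t : L0 alpha f ->
  (t < dist f l)%E -> exists2 l', l < l' & (t < dist f l')%E.
Proof.
move=> mf tl; apply: contrapT => h; move: tl; apply/negP; rewrite -leNgt.
pose F n := [set s | D s /\ ((l + n.+1%:R^-1)%:E < `|f s|)%E].
have mF n : measurable (F n) by exact: measurable_superlevel.
have FE : \bigcup_n F n = [set s | D s /\ (l%:E < `|f s|)%E].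
  apply/seteqP; split=> [s [n _ [Ds h1]]|s [Ds ls]].
    by split=> //; apply: lt_trans h1; rewrite lte_fin ltrDl invr_gt0.
  have [m lm] : exists m : nat, ((l + m.+1%:R^-1)%:E < `|f s|)%E.
    move: ls; case: `|f s|%E => [r| |] //; rewrite ?lte_fin => lr.
      have rl : 0 < r - l by rewrite subr_gt0.
      have [m _ /(_ _ (leqnn m))] := near_infty_natSinv_lt (PosNum rl).
      by move=> hm; exists m; rewrite lte_fin -ltrBrDl; exact: hm.
    by exists 0%N; rewrite ltry.
  by exists m.
have : mu \o F @ \oo --> mu (\bigcup_n F n).
  apply: nondecreasing_cvg_mu => //; first exact: bigcupT_measurable.
  move=> m n mn; apply/subsetPset => s [Ds h1]; split=> //.
  by apply: le_lt_trans h1; rewrite lee_fin lerD2l lef_pV2 ?posrE// ler_nat.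
rewrite FE; apply: cvge_le; apply: nearW => n /=; rewrite leNgt; apply/negP => tn.
by apply: h; exists (l + n.+1%:R^-1) => //; rewrite ltrDl invr_gt0.
Qed.

Local Notation rearr := (rearrangement alpha).

Lemma rearrangement_ge0 f t : (0 <= rearr f t)%E.
Proof. by apply: le_ereal_inf_tmp => _ [l [l0 _] <-]; rewrite lee_fin ltW. Qed.

Lemma rearrangement_le f l t : L0 alpha f -> 0 <= l ->
  (dist f l <= t%:E)%E -> (rearr f t <= l%:E)%E.
Proof.
(* [l] may be 0 while the infimum ranges over positive levels, hence [l + e]. *)
move=> mf l0 dl; apply/lee_addgt0Pr => e e0.
apply: ereal_inf_lbound; exists (l + e) => //; split; first lra.
by apply: le_trans dl; apply: nonincreasing_distribution_fun => //; lra.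
Qed.

Lemma rearrangement_gt f l t : L0 alpha f ->
  (t%:E < dist f l)%E -> (l%:E < rearr f t)%E.
Proof.
move=> mf /(distribution_fun_right_continuous mf)[l' ll' tl'].
apply: (@lt_le_trans _ _ l'%:E); first by rewrite lte_fin.
apply: le_ereal_inf_tmp => _ [k [k0 dk] <-]; rewrite lee_fin leNgt; apply/negP => kl'.
move: tl'; apply/negP; rewrite -leNgt; apply: le_trans dk.
by apply: nonincreasing_distribution_fun => //; exact: ltW.
Qed.

(** The exchange of level and measure that identifies the superlevel sets of a rearrangement; the
    implication from right to left rests on right continuity of the distribution function. *)
Lemma rearrangement_gtE f l t : L0 alpha f -> 0 <= l ->
  (l%:E < rearr f t)%E = (t%:E < dist f l)%E.
Proof.
move=> mf l0; apply/idP/idP; last exact: rearrangement_gt.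
by apply: contraTT; rewrite -!leNgt; exact: rearrangement_le.
Qed.

Lemma rearrangement_anti f s t : s <= t -> (rearr f t <= rearr f s)%E.
Proof.
move=> st; apply: le_ereal_inf_tmp => _ [l [l0 dl] <-].
apply: ereal_inf_lbound; exists l => //; split=> //.
by apply: le_trans dl _; rewrite lee_fin.
Qed.

(** The superlevel sets of such a function within the domain are intervals. *)
Lemma antitone_L0 g :
  (forall s t, D s -> D t -> s <= t -> (g t <= g s)%E) -> L0 alpha g.
Proof.
move=> gd; rewrite /L0 /=.
move=> mD; apply: (measurability _ (ErealGenOInfty.measurableE R)) => //.
move=> _ [_ [x ->] <-].
apply: is_interval_measurable => s t /= [Ds gs] [Dt gt] u /andP[su ut].
have Du : D u.
  case: Ds Dt => s0 _ [_ ta]; split; first exact: le_trans su.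
  by apply: le_lt_trans ta; rewrite lee_fin.
split=> //; move: gt; rewrite !in_itv/= !andbT => gt.
by apply: lt_le_trans gt (gd _ _ Du Dt ut).
Qed.

Lemma rearrangement_L0 f : L0 alpha (rearr f).
Proof. by apply: antitone_L0 => s t _ _; exact: rearrangement_anti. Qed.

Lemma distribution_fun_rearrangement f : L0 alpha f -> dist (rearr f) = dist f.
Proof.
move=> mf; apply/funext => l; have [l0|l0] := ltP l 0.
  exact: distribution_fun_lt0.
(* By [rearrangement_gtE] the superlevel set of the rearrangement is [[0, dist f l)], that is, [dom]
   taken at [dist f l]. *)
transitivity (mu (dom (dist f l))); last by rewrite lebesgue_measure_dom // distribution_fun_ge0.
congr mu; apply/seteqP; split=> t /=.
  move=> [Dt]; rewrite gee0_abs ?rearrangement_ge0 // rearrangement_gtE // => tl.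
  by split=> //; case: Dt.
move=> [t0 tl]; split.
  apply: dom_lt_measure tl => //; first exact: measurable_superlevel.
  by move=> s [].
by rewrite gee0_abs ?rearrangement_ge0 // rearrangement_gtE.
Qed.

(** Where [rearr g t < g t], a rational [q] lies strictly between. Each [q] serves at most one [t]:
    if it served [s < t], then [g > q] on [[0, t)], which forces [rearr g s > q]. So the exceptional
    set is countable. *)
Lemma rearrangement_antitone g :
  (forall t, D t -> (0 <= g t)%E) ->
  (forall s t, D s -> D t -> s <= t -> (g t <= g s)%E) ->
  aeq alpha (rearr g) g.
Proof.
move=> g0 gd; have mg := antitone_L0 gd.
have le_rg t : D t -> (rearr g t <= g t)%E.
  move=> Dt; have := g0 _ Dt; case E : (g t) => [r| |] // r0; last exact: leey.
  apply: rearrangement_le => //; rewrite -[leRHS]lebesgue_measure_dom; last by case: Dt.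
  apply: le_measure; rewrite ?inE //.
  - exact: measurable_superlevel.
  - exact: measurable_dom.
  move=> s [Ds rs]; case: (Ds) => s0 _; split=> //.
  rewrite lte_fin ltNge; apply/negP => ts; move: rs; apply/negP.
  by rewrite -leNgt gee0_abs ?g0 // -E gd.
pose A (q : rat) := [set t | D t /\ (rearr g t < (ratr q)%:E < g t)%E].
have A1 q s t : A q s -> A q t -> s < t -> False.
  move=> [Ds /andP[rs sq]] [Dt /andP[rt tq]] st.
  move: rs; apply/negP; rewrite -leNgt; apply: ltW; apply: rearrangement_gt => //.
  have t0 : (0 <= t%:E)%E by case: Dt.
  apply: (@lt_le_trans _ _ (mu (dom t%:E))).
    by rewrite lebesgue_measure_dom // lte_fin.
  apply: le_measure; rewrite ?inE.
  - exact: measurable_dom.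
  - exact: measurable_superlevel.
  move=> u [u0 ut]; have Du : D u.
    by split=> //; case: Dt => _; exact: lt_trans.
  split=> //; rewrite gee0_abs ?g0 //; apply: lt_le_trans tq _.
  by apply: gd => //; rewrite ltW // -lte_fin.
have cA : countable (\bigcup_q A q).
  apply: bigcup_countable => // q _; apply: finite_set_countable.
  have [[t At]|nA] := pselect (exists t, A q t).
    apply: (sub_finite_set _ (finite_set1 t)) => s As /=.
    by have [st|ts|//] := ltgtP s t; [case: (A1 _ _ _ As At st)|case: (A1 _ _ _ At As ts)].
  by apply: (sub_finite_set _ (finite_set0 _)) => s As; apply: nA; exists s.
have nA : mu.-negligible (\bigcup_q A q).
  apply/negligibleP; last exact: countable_lebesgue_measure0.
  exact: countable_measurable.
apply: negligibleS nA => t /= /not_implyP[Dt /eqP rg].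
have {}rg : (rearr g t < g t)%E by rewrite lt_neqAle rg le_rg.
have [q rq] : exists q : rat, (rearr g t < (ratr q)%:E < g t)%E.
  move: rg (rearrangement_ge0 g t).
  case: (rearr g t) => [a| |] //; case: (g t) => [b| |] //; rewrite ?lte_fin => ab a0.
    have [q] := rat_in_itvoo ab; rewrite in_itv /= => qab.
    by exists q; rewrite !lte_fin.
  have [q] := rat_in_itvoo (ltr_pwDr ltr01 (lexx a)).
  by rewrite in_itv /= => /andP[qab _]; exists q; rewrite !lte_fin qab ltry.
by exists q.
Qed.

End Rearrangement.

(** * Step functions over finite disjoint families *)

Section StepFunctions.
Context {R : realType} (alpha : \bar R).
Local Notation D := (dom alpha).
Local Notation mu := (@lebesgue_measure R).
Local Notation dist := (distribution_fun alpha).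

Definition step (J : finType) (A : J -> set R) (c : J -> R) (t : R) : R :=
  \sum_j c j * \1_(A j) t.

Lemma step_in (J : finType) (A : J -> set R) c j t :
  trivIset setT A -> A j t -> step A c t = c j.
Proof.
move=> tA Ajt; rewrite /step (bigD1 j) //= big1 ?addr0 => [|l lj].
  by rewrite indicE mem_set // mulr1.
rewrite indicE memNset ?mulr0 // => Alt; move/eqP: lj; apply.
by apply: (tA l j) => //; exists t.
Qed.

Lemma step_out (J : finType) (A : J -> set R) c t :
  (forall j, ~ A j t) -> step A c t = 0.
Proof. by move=> nA; apply: big1 => j _; rewrite indicE memNset // mulr0. Qed.

Lemma sum_step (I J : finType) (A : J -> set R) (c : I -> J -> R) t :
  \sum_i step A (c i) t = step A (fun j => \sum_i c i j) t.
Proof.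
rewrite /step exchange_big; apply: eq_bigr => j _.
by rewrite mulr_suml.
Qed.

Lemma measurable_step (J : finType) (A : J -> set R) c (B : set R) :
  (forall j, measurable (A j)) -> measurable_fun B (step A c).
Proof.
by move=> mA; apply: measurable_sum => j; apply: measurable_funM.
Qed.

Lemma step_L0 (J : finType) (A : J -> set R) c :
  (forall j, measurable (A j)) -> L0 alpha (EFin \o step A c).
Proof. by move=> mA; apply/measurable_EFinP; exact: measurable_step. Qed.

Lemma distribution_fun_step (J : finType) (A : J -> set R) c l : 0 <= l ->
  trivIset setT A -> (forall j, measurable (A j)) -> (forall j, A j `<=` D) ->
  dist (EFin \o step A c) l = (\sum_(j \in [set j | (l < `|c j|)%R]) mu (A j))%E.
Proof.
move=> l0 tA mA AD.
have mE : mu (\bigcup_(j in [set j | l < `|c j|]) A j) =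
    (\sum_(j \in [set j | (l < `|c j|)%R]) mu (A j))%E.
  by apply: measure_fin_bigcup; [exact: finite_finset|exact: sub_trivIset tA|move=> j _; exact: mA].
rewrite -mE; congr mu; apply/seteqP; split=> t /=.
  move=> [Dt lt]; have [[j Ajt]|nA] := pselect (exists j, A j t).
    by exists j => //=; rewrite -(step_in c tA Ajt).
  move: lt; rewrite step_out ?normr0 ?lte_fin 1?ltNge ?l0 // => j Ajt.
  by apply: nA; exists j.
move=> [j lc Ajt]; split; first exact: AD Ajt.
by rewrite (step_in c tA Ajt) lte_fin.
Qed.

Lemma distribution_fun_step_eq (J : finType) (A B : J -> set R) c :
  trivIset setT A -> (forall j, measurable (A j)) -> (forall j, A j `<=` D) ->
  trivIset setT B -> (forall j, measurable (B j)) -> (forall j, B j `<=` D) ->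
  (forall j, mu (A j) = mu (B j)) ->
  dist (EFin \o step A c) = dist (EFin \o step B c).
Proof.
move=> tA mA AD tB mB BD AB; apply/funext => l; have [l0|l0] := ltP l 0.
  exact: distribution_fun_lt0.
by rewrite !distribution_fun_step //; apply: eq_fsbigr => j _.
Qed.

End StepFunctions.

(** * Norm bounds stated for functions *)

Section NormBound.
Context {R : realType} (alpha : \bar R) (E : banach_function_space alpha).
Implicit Types (f g : R -> \bar R) (r : R).
Local Notation D := (dom alpha).

(** Membership in [E] is carried along with the bound, so that the ideal property, symmetry, the
    Fatou property and convexity become rules for passing from one function to another. *)
Definition norm_le f r := exists x : E, aeq alpha (bfs_fun x) f /\ `|x| <= r.

Lemma norm_le_ideal f g r : L0 alpha f ->
  ae_on alpha (fun t => `|f t| <= `|g t|)%E -> norm_le g r -> norm_le f r.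
Proof.
move=> mf fg [y [yg yr]].
have [|x [xf xy]] := @bfs_ideal _ _ E f y mf; last first.
  by exists x; split=> //; exact: le_trans yr.
by apply: ae_onS2 fg yg => t _ fg ->.
Qed.

Lemma norm_le_distribution f g r : symmetric_space E -> L0 alpha f ->
  L0 alpha g -> distribution_fun alpha f = distribution_fun alpha g ->
  norm_le g r -> norm_le f r.
Proof.
move=> Esym mf mg fg [y [yg yr]].
have [|x [xf xy]] := Esym f y mf; last by exists x; split=> //; rewrite xy.
by rewrite fg; apply: distribution_fun_aeq => //; [exact: bfs_L0|exact: aeq_sym].
Qed.

Lemma norm_le_fatou (f_ : nat -> R -> \bar R) f r : fatou_property E ->
  L0 alpha f ->
  (forall n t, D t -> (0 <= f_ n t)%E) ->
  (forall n t, D t -> (f_ n t <= f_ n.+1 t)%E) ->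
  (forall t, D t -> f_ ^~ t @ \oo --> f t) ->
  (forall n, norm_le (f_ n) r) -> norm_le f r.
Proof.
move=> Efatou mf f0 nd fc /choice[x xP].
have xf n : aeq alpha (bfs_fun (x n)) (f_ n) by have [] := xP n.
have xr n : `|x n| <= r by have [] := xP n.
have [||||y [yf _ xy]] := Efatou x f _ _ mf.
- by move=> n; apply: ae_onS (xf n) => t Dt ->; exact: f0.
- by exists r.
- by move=> n; apply: ae_onS2 (xf n) (xf n.+1) => t Dt -> ->; exact: nd.
- have : ae_on alpha (fun t => forall n, bfs_fun (x n) t = f_ n t).
    exact: ae_on_forall.
  apply: ae_onS => t Dt xft.
  rewrite (_ : (fun n => _) = f_ ^~ t); first exact: fc.
  by apply/funext => n.
exists y; split=> //; move/cvg_lim : (xy) => <- //.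
apply: limr_le; first by apply/cvg_ex; exists `|y|.
exact: nearW.
Qed.

Lemma norm_le_convex (f g : R -> R) (a r : R) : 0 <= a <= 1 ->
  norm_le (EFin \o f) r -> norm_le (EFin \o g) r ->
  norm_le (fun t => (a * f t + (1 - a) * g t)%:E) r.
Proof.
move=> /andP[a0 a1] [x [xf xr]] [y [yg yr]].
exists (a *: x + (1 - a) *: y); split.
  apply: aeq_trans (bfs_add _ _) _.
  have ax : aeq alpha (bfs_fun (a *: x)) (fun t => (a * f t)%:E).
    by apply: ae_onS2 (bfs_scale a x) xf => t _ -> ->; rewrite EFinM.
  have ay : aeq alpha (bfs_fun ((1 - a) *: y)) (fun t => ((1 - a) * g t)%:E).
    by apply: ae_onS2 (bfs_scale (1 - a) y) yg => t _ -> ->; rewrite EFinM.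
  by apply: ae_onS2 ax ay => t _ -> ->; rewrite EFinD.
apply: le_trans (ler_normD _ _) _; rewrite !normrZ !ger0_norm ?subr_ge0 //.
have := ler_wpM2l a0 xr; have := @ler_wpM2l _ (1 - a) _ _ _ yr.
rewrite subr_ge0 => /(_ a1); lra.
Qed.

End NormBound.

(** * The sum inequality on a grid of cells of equal length *)

Section Grid.
Context {R : realType} (alpha : \bar R).
Local Notation D := (dom alpha).
Local Notation mu := (@lebesgue_measure R).
Local Notation dist := (distribution_fun alpha).
Local Notation rearr := (rearrangement alpha).

Definition cell (h : R) (q : nat) : set R := [set t | q%:R * h <= t < q.+1%:R * h].

Lemma cell_truncn (h t : R) : 0 < h -> 0 <= t -> cell h (Num.truncn (t / h)) t.
Proof.
move=> h0 t0; have /truncn_itv := divr_ge0 t0 (ltW h0).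
by rewrite /cell /= ler_pdivlMr // ltr_pdivrMr.
Qed.

Lemma cellE (h t : R) q : 0 < h -> cell h q t -> q = Num.truncn (t / h).
Proof.
move=> h0 /andP[t1 t2]; apply/esym/truncn_def.
by rewrite ler_pdivlMr // ltr_pdivrMr // t1.
Qed.

Lemma cell_itv h q : cell h q = [set` `[q%:R * h, q.+1%:R * h[].
Proof. by apply/seteqP; split=> t /=; rewrite in_itv. Qed.

Lemma measurable_cell h q : measurable (cell h q).
Proof. by rewrite cell_itv; exact: measurable_itv. Qed.

Lemma lebesgue_measure_cell h q : 0 < h -> mu (cell h q) = h%:E.
Proof.
move=> h0; rewrite cell_itv lebesgue_measure_itv /= lte_fin.
by rewrite ltr_pM2r // ltr_nat ltnSn -EFinB -mulrBl -natrB // subSnn mul1r.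
Qed.

Lemma trivIset_cell (h : R) (N : nat) : 0 < h ->
  trivIset setT (fun q : 'I_N => cell h q).
Proof.
move=> h0; apply/trivIsetP => p q _ _ pq; apply/seteqP; split=> // t [/= tp tq].
by move/eqP: pq; apply; apply/val_inj; rewrite /= (cellE h0 tp) (cellE h0 tq).
Qed.

(** Permuting the values amounts to permuting the cells, which are disjoint and of equal measure
    [h]. *)
Lemma distribution_fun_cell_perm (h : R) N (v : 'I_N -> R) (s : {perm 'I_N}) :
  0 < h -> (forall q : 'I_N, cell h q `<=` D) ->
  dist (EFin \o step (cell h : 'I_N -> set R) (v \o s)) =
  dist (EFin \o step (cell h : 'I_N -> set R) v).
Proof.
move=> h0 cD.
pose A q := cell h ((s^-1)%g q : 'I_N).
have -> : step (cell h : 'I_N -> set R) (v \o s) = step A v.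
  apply/funext => t; rewrite /step (reindex_inj (@perm_inj _ (s^-1)%g)) /=.
  by apply: eq_bigr => q _; rewrite permKV.
apply: distribution_fun_step_eq => //.
- apply/trivIsetP => p q _ _ pq; apply/seteqP; split=> // t [/= tp tq].
  move/eqP: pq; apply; apply: (@perm_inj _ (s^-1)%g); apply/val_inj => /=.
  by rewrite (cellE h0 tp) (cellE h0 tq).
- by move=> j; exact: measurable_cell.
- by move=> j; exact: cD.
- exact: trivIset_cell.
- by move=> j; exact: measurable_cell.
- by move=> j; rewrite !lebesgue_measure_cell.
Qed.

(** [perm_sorted_induction] with [B] the norm bound: symmetry gives invariance under permutations,
    the norm gives convexity, and sorted rows lie pointwise below the rearrangements of the
    [x i]. *)
Lemma norm_le_grid (E : banach_function_space alpha) (Esym : symmetric_space E)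
    (h : R) N (I : finType) (u : I -> 'I_N -> R) (x : I -> R -> \bar R) r :
  0 < h -> (forall q : 'I_N, cell h q `<=` D) -> (forall i q, 0 <= u i q) ->
  (forall i, L0 alpha (x i)) ->
  (forall i l, 0 <= l ->
    (dist (EFin \o step (cell h : 'I_N -> set R) (u i)) l <= dist (x i) l)%E) ->
  norm_le E (fun t => \sum_i rearr (x i) t)%E r ->
  norm_le E (EFin \o step (cell h : 'I_N -> set R) (fun q => \sum_i u i q)) r.
Proof.
move=> h0 cD u0 mx ux xr.
have mc (q : 'I_N) : measurable (cell h q) by exact: measurable_cell.
pose B v := norm_le E (EFin \o step (cell h : 'I_N -> set R) v) r.
apply: (@perm_sorted_induction _ _ _ B) => [v s Bv|v w a a01 Bv Bw|s sorted].
- apply: norm_le_distribution Bv => //; [exact: step_L0|exact: step_L0|].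
  exact: distribution_fun_cell_perm.
- rewrite /B (_ : EFin \o _ = fun t =>
      (a * step (cell h : 'I_N -> set R) v t +
       (1 - a) * step (cell h : 'I_N -> set R) w t)%:E).
    exact: norm_le_convex.
  apply/funext => t /=; congr EFin; rewrite /step !mulr_sumr -big_split.
  by apply: eq_bigr => q _ /=; ring.
- apply: norm_le_ideal xr; first exact: step_L0.
  apply: ae_onW => t Dt; have t0 : 0 <= t by case: Dt.
  have sum0 : (0 <= \sum_i rearr (x i) t)%E.
    by apply: sume_ge0 => i _; exact: rearrangement_ge0.
  rewrite (gee0_abs sum0).
  have [[q tq]|nq] := pselect (exists q : 'I_N, cell h q t); last first.
    by rewrite /= step_out ?normr0 // => q tq; apply: nq; exists q.
  rewrite /= (step_in _ (trivIset_cell h0) tq) ger0_norm ?sumr_ge0 //.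
  rewrite -sumEFin; apply: lee_sum => i _.
  (* If the sorted value on the cell [q] of [t] exceeded [l = rearr (x i) t], the sorted step
     function would exceed [l] on [[0, (q+1) h)], of measure greater than [t]; then
     [dist (x i) l > t], whence [rearr (x i) t > l]. *)
  rewrite leNgt; apply/negP => lt_ru.
  have := rearrangement_ge0 alpha (x i) t; move: lt_ru.
  case Er : (rearr (x i) t) => [l| |] //; rewrite lte_fin lee_fin => lu l0.
  suff : (l%:E < rearr (x i) t)%E by rewrite Er ltxx.
  apply: rearrangement_gt => //; apply: lt_le_trans (ux i l l0).
  rewrite -(distribution_fun_cell_perm (u i) (s i)) //.
  case/andP: (tq) => tq1 tq2.
  apply: (@lt_le_trans _ _ (mu (dom (q.+1%:R * h)%:E))).
    rewrite lebesgue_measure_dom ?lte_fin //.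
    by rewrite lee_fin mulr_ge0 // ltW.
  apply: le_measure; rewrite ?inE.
  + exact: measurable_dom.
  + by apply: measurable_superlevel; exact: step_L0.
  move=> y [y0 yq]; have yc := cell_truncn h0 y0.
  have yq' : (Num.truncn (y / h) <= q)%N.
    rewrite -ltnS truncn_lt_nat ?divr_ge0 // ?(ltW h0) //.
    by rewrite ltr_pdivrMr // -lte_fin.
  have yN : (Num.truncn (y / h) < N)%N by exact: leq_ltn_trans yq' (ltn_ord q).
  split; first exact: (cD (Ordinal yN)).
  rewrite /= (step_in _ (trivIset_cell h0) (yc : cell h (Ordinal yN) y)) lte_fin.
  rewrite /= ger0_norm // (lt_le_trans lu) //.
  exact: sorted.
Qed.

End Grid.

(** * From grids to disjoint open intervals by dyadic approximation *)

Section Layout.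
Context {R : realType} (alpha : \bar R).
Local Notation D := (dom alpha).
Local Notation mu := (@lebesgue_measure R).
Local Notation dist := (distribution_fun alpha).
Local Notation rearr := (rearrangement alpha).

Definition dyadic (n : nat) (t : R) : nat := Num.truncn (t / 2 ^- n).

(** Tests whether the dyadic cell of level [n] around [t] lies in []a, b[]. The cell contains its
    left end but not its right end, hence one strict and one weak inequality. *)
Definition inner (a b : R) (n : nat) (t : R) : bool :=
  (a < (dyadic n t)%:R * 2 ^- n) && ((dyadic n t).+1%:R * 2 ^- n <= b).

Lemma expN2_gt0 n : 0 < 2 ^- n :> R.
Proof. by rewrite invr_gt0 exprn_gt0. Qed.

Lemma dyadic_itv n t : 0 <= t ->
  (dyadic n t)%:R * 2 ^- n <= t < (dyadic n t).+1%:R * 2 ^- n.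
Proof. exact: cell_truncn (expN2_gt0 n). Qed.

Lemma inner_in a b n t : 0 <= t -> inner a b n t -> t \in `]a, b[.
Proof.
move=> t0 /andP[h1 h2]; have /andP[h3 h4] := dyadic_itv n t0.
by rewrite in_itv /= (lt_le_trans h1 h3) (lt_le_trans h4 h2).
Qed.

Lemma expN2S n : 2 ^- n = 2 * 2 ^- n.+1 :> R.
Proof. by rewrite exprS invfM mulrA divff ?mul1r. Qed.

(** Dyadic cells are nested: the cell of level [n.+1] is one half of the cell of level [n]. *)
Lemma innerS a b n t : 0 <= t -> inner a b n t -> inner a b n.+1 t.
Proof.
move=> t0 /andP[h1 h2]; have /andP[h3 h4] := dyadic_itv n t0.
have h := expN2_gt0 n.+1.
have q1 : ((dyadic n t).*2 <= dyadic n.+1 t)%N.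
  rewrite /dyadic truncn_ge_nat ?divr_ge0 // ?(ltW h) // ler_pdivlMr //.
  by rewrite -muln2 natrM -mulrA -expN2S.
have q2 : (dyadic n.+1 t < (dyadic n t).+1.*2)%N.
  rewrite /dyadic truncn_lt_nat ?divr_ge0 // ?(ltW h) // ltr_pdivrMr //.
  by rewrite -muln2 natrM -mulrA -expN2S.
rewrite /inner; apply/andP; split.
  apply: lt_le_trans h1 _; rewrite (expN2S n) mulrA ler_pM2r // -natrM ler_nat.
  by rewrite muln2.
apply: le_trans h2; rewrite (expN2S n) [leRHS]mulrA ler_pM2r // -natrM ler_nat.
by rewrite muln2.
Qed.

(** The interval is open and the cells around [t] shrink to [t]. *)
Lemma inner_near a b t : 0 <= t ->
  \forall n \near \oo, inner a b n t = (t \in `]a, b[).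
Proof.
move=> t0; have [|tab] := boolP (t \in `]a, b[); last first.
  by apply: nearW => n; apply/negP => /(inner_in t0); exact/negP.
rewrite in_itv /= => /andP[ta tb].
have ta0 : 0 < t - a by rewrite subr_gt0.
have tb0 : 0 < b - t by rewrite subr_gt0.
near=> n.
have h1 : 2 ^- n < t - a.
  rewrite -[_^-1]mul1r; near: n; exact: (near_infty_natSinv_expn_lt (PosNum ta0)).
have h2 : 2 ^- n < b - t.
  rewrite -[_^-1]mul1r; near: n; exact: (near_infty_natSinv_expn_lt (PosNum tb0)).
have /andP[h3 h4] := dyadic_itv n t0.
rewrite /inner; move: h4; rewrite -natr1 mulrDl mul1r => h4.
by apply/andP; split; lra.
Unshelve. all: by end_near. Qed.

Lemma inner_out a b n t : 0 <= t -> b < (dyadic n t).+1%:R * 2 ^- n ->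
  inner a b n t = false.
Proof. by move=> t0 h; apply/negP => /andP[_]; rewrite leNgt h. Qed.

(** Replacing each interval by the dyadic cells inside it gives functions on a grid, which
    [norm_le_grid] bounds. They increase with [n] to the given step function, and the Fatou property
    passes to the limit. *)
Lemma norm_le_layout (E : banach_function_space alpha)
    (Esym : symmetric_space E) (Efatou : fatou_property E)
    (beta : R) (I J : finType) (a b : J -> R) (c : I -> J -> R)
    (x : I -> R -> \bar R) r :
  0 <= beta -> dom beta%:E `<=` D -> (forall j, b j <= beta) ->
  trivIset setT (fun j => [set` `]a j, b j[] : set R) ->
  (forall i j, 0 <= c i j) -> (forall i, L0 alpha (x i)) ->
  (forall i l, 0 <= l ->
    (dist (EFin \o step (fun j => [set` `]a j, b j[]) (c i)) l <= dist (x i) l)%E) ->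
  norm_le E (fun t => \sum_i rearr (x i) t)%E r ->
  norm_le E (EFin \o step (fun j => [set` `]a j, b j[]) (fun j => \sum_i c i j)) r.
Proof.
move=> beta0 bD bbeta tab c0 mx cx xr.
have mab j : measurable ([set` `]a j, b j[] : set R) by exact: measurable_itv.
pose C j := \sum_i c i j.
have C0 j : 0 <= C j by exact: sumr_ge0.
pose low (w : J -> R) n t := \sum_j w j * (inner (a j) (b j) n t)%:R.
have stepE w t : step (fun j => [set` `]a j, b j[] : set R) w t =
    \sum_j w j * (t \in `]a j, b j[)%:R.
  by apply: eq_bigr => j _; rewrite indicE mem_setE.
(* The cells of index below [dyadic n beta] are those contained in [[0, beta)]; they include every
   cell inside some []a j, b j[], since [b j <= beta]. *)
pose N n := dyadic n beta.
pose u (w : J -> R) n (q : 'I_(N n)) : R :=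
  \sum_j w j * ((a j < q%:R * 2 ^- n) && (q.+1%:R * 2 ^- n <= b j))%:R.
have lowE w n t : 0 <= t ->
    low w n t = step (cell (2 ^- n) : 'I_(N n) -> set R) (u w n) t.
  move=> t0; have tc := cell_truncn (expN2_gt0 n) t0.
  have [qN|qN] := ltnP (dyadic n t) (N n).
    by rewrite (step_in _ (trivIset_cell (expN2_gt0 n)) (tc : cell _ (Ordinal qN) t)).
  rewrite step_out => [|q tq]; last first.
    move: qN; rewrite /dyadic -(cellE (expN2_gt0 n) tq) leqNgt => /negP; apply.
    exact: ltn_ord.
  apply: big1 => j _; rewrite inner_out ?mulr0 //.
  apply: le_lt_trans (bbeta j) _; have /andP[_] := dyadic_itv n beta0.
  move/lt_le_trans; apply.
  by rewrite ler_pM2r ?expN2_gt0 // ler_nat ltnS.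
have cD n (q : 'I_(N n)) : cell (2 ^- n) q `<=` D.
  move=> t /andP[t1 t2]; apply: bD; split.
    by apply: le_trans t1; rewrite mulr_ge0 // ltW // expN2_gt0.
  rewrite lte_fin; apply: lt_le_trans t2 _.
  have /andP[h _] := dyadic_itv n beta0; apply: le_trans h.
  by rewrite ler_pM2r ?expN2_gt0 // ler_nat ltn_ord.
have mcell n (q : 'I_(N n)) : measurable (cell (2 ^- n : R) q) by exact: measurable_cell.
have u0 (w : J -> R) n q : (forall j, 0 <= w j) -> 0 <= u w n q.
  by move=> w0; apply: sumr_ge0 => j _; rewrite mulr_ge0.
apply: (@norm_le_fatou _ _ E (fun n => EFin \o low C n)) => //.
- exact: step_L0.
- by move=> n t _; rewrite lee_fin; apply: sumr_ge0 => j _; rewrite mulr_ge0.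
- move=> n t [t0 _]; rewrite lee_fin; apply: ler_sum => j _.
  rewrite ler_wpM2l // ler_nat.
  by case E1 : (inner _ _ n t) => //; rewrite (innerS t0 E1).
- move=> t [t0 _] /=; apply: cvg_near_cst.
  have : \forall n \near \oo, forall j, inner (a j) (b j) n t = (t \in `]a j, b j[).
    by apply: filter_forall => j; exact: inner_near.
  apply: filterS => n nE; rewrite stepE; congr EFin; apply: eq_bigr => j _.
  by rewrite nE.
move=> n; pose v (i : I) := u (c i) n.
have uE : u C n = fun q => \sum_i v i q.
  apply/funext => q; rewrite /v /u exchange_big; apply: eq_bigr => j _.
  by rewrite mulr_suml.
have := @norm_le_grid _ _ E Esym (2 ^- n) (N n) I v x r (expN2_gt0 n) (@cD n)
  (fun i q => u0 _ _ _ (c0 i)) mx _ xr.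
rewrite -uE => h; apply: norm_le_ideal (h _).
- apply: (eq_measurable_fun (EFin \o step (cell (2 ^- n) : 'I_(N n) -> set R) (u C n))).
    by move=> t /set_mem[t0 _]; rewrite /= lowE.
  exact: step_L0.
- by apply: ae_onW => t [t0 _]; rewrite /= lowE.
move=> i l l0; apply: le_trans (cx i l l0).
apply: le_distribution_fun; [exact: step_L0|exact: step_L0|].
apply: ae_onW => t [t0 _]; rewrite /= -lowE // stepE lee_fin.
rewrite !ger0_norm; try by apply: sumr_ge0 => j _; rewrite mulr_ge0.
apply: ler_sum => j _; rewrite ler_wpM2l // ler_nat.
by case E1 : (inner _ _ n t) => //; rewrite (inner_in t0 E1).
Qed.

End Layout.
Import HBNNSimple.

(** * The sum inequality for measurable functions *)

Section Submajorization.
Context {R : realType} (alpha : \bar R) (E : banach_function_space alpha).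
Context (Esym : symmetric_space E) (Efatou : fatou_property E).
Local Notation D := (dom alpha).
Local Notation mu := (@lebesgue_measure R).
Local Notation dist := (distribution_fun alpha).
Local Notation rearr := (rearrangement alpha).

(** The sets [A j] are replaced by consecutive intervals of the same measures. This keeps all
    distribution functions, so symmetry reduces the claim to [norm_le_layout]. *)
Lemma norm_le_step p (A : 'I_p -> set R) (I : finType) (c : I -> 'I_p -> R)
    (x : I -> R -> \bar R) r :
  trivIset setT A -> (forall j, measurable (A j)) -> (forall j, A j `<=` D) ->
  (forall j, (mu (A j) < +oo)%E) ->
  (forall i j, 0 <= c i j) -> (forall i, L0 alpha (x i)) ->
  (forall i l, 0 <= l -> (dist (EFin \o step A (c i)) l <= dist (x i) l)%E) ->
  norm_le E (fun t => \sum_i rearr (x i) t)%E r ->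
  norm_le E (EFin \o step A (fun j => \sum_i c i j)) r.
Proof.
move=> tA mA AD fA c0 mx cx xr.
pose w j := fine (mu (A j)).
have w0 j : 0 <= w j by exact: fine_ge0.
have wE j : mu (A j) = (w j)%:E by rewrite fineK // ge0_fin_numE.
pose T n := \sum_(l < p | (l < n)%N) w l.
have TS (j : 'I_p) : T j.+1 = T j + w j.
  rewrite /T (bigD1 j) //= addrC; congr (_ + _).
  by apply: eq_bigl => l; rewrite ltnS ltn_neqAle andbC.
have leT m n : (m <= n)%N -> T m <= T n.
  move=> mn; rewrite /T big_mkcond [leRHS]big_mkcond; apply: ler_sum => l _.
  case: ifP => [lm|_]; last by case: ifP.
  by rewrite (leq_trans lm mn).
have T0 n : 0 <= T n by exact: sumr_ge0.
pose J (j : 'I_p) : set R := [set` `]T j, (T j.+1)[].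
have tJ : trivIset setT J.
  apply/trivIsetP => j l _ _ jl; apply/seteqP; split=> // t [].
  rewrite /J /= !in_itv /= => /andP[t1 t2] /andP[t3 t4].
  case: (ssrnat.ltngtP j l) => [lt|lt|jl']; last by move/eqP: jl; apply; exact: ord_inj.
    by have := lt_trans t3 t2; rewrite ltNge leT.
  by have := lt_trans t1 t4; rewrite ltNge leT.
have mJ j : measurable (J j) by exact: measurable_itv.
have muJ j : mu (J j) = mu (A j).
  rewrite lebesgue_measure_itv /= lte_fin wE TS ltrDl -EFinB.
  case: ltP => [_|w0']; first by rewrite addrAC subrr add0r.
  by congr EFin; apply/le_anti; rewrite w0 w0'.
have Tp : T p = \sum_j w j by apply: eq_bigl => l; rewrite ltn_ord.
(* The total length [T p] is the measure of the union of the [A j], which lies in the domain, so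
   there is room for the intervals. *)
have domT : dom (T p)%:E `<=` D.
  move=> t [t0 tT]; apply: (@dom_lt_measure _ _ (\bigcup_(j in setT) A j)) => //.
  - by apply: fin_bigcup_measurable => [|j _]; [exact: finite_finset|exact: mA].
  - by move=> s [j _]; exact: AD.
  have -> : mu (\bigcup_(j in setT) A j) = (\sum_(j \in setT) mu (A j))%E.
    by apply: measure_fin_bigcup => [|//|j _]; [exact: finite_finset|exact: mA].
  rewrite (_ : [set: 'I_p] = [set` index_enum 'I_p]).
    rewrite -fsbig_seq ?index_enum_uniq //.
    by rewrite (eq_bigr _ (fun j _ => wE j)) sumEFin -Tp.
  by apply/seteqP; split=> // j _; exact: mem_index_enum.
have JD j : J j `<=` D.
  move=> t; rewrite /J /= in_itv /= => /andP[t1 t2]; apply: domT; split.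
    by apply: le_trans (ltW t1).
  by rewrite lte_fin (lt_le_trans t2) // leT.
have distE v : dist (EFin \o step A v) = dist (EFin \o step J v).
  by apply: distribution_fun_step_eq.
apply: (norm_le_distribution Esym _ _ (distE _)); try exact: step_L0.
apply: (@norm_le_layout _ _ E Esym Efatou (T p) I 'I_p (fun j => T j)
  (fun j => T j.+1) c x) => //.
- by move=> j; exact: leT.
- by move=> i l l0; rewrite -/J -distE; exact: cx.
Qed.

(** Each [|x i|] is the increasing limit of simple functions, cut off at [t < n] to have support of
    finite measure. For fixed [n] these are all constant on the sets of one finite partition, so
    [norm_le_step] bounds their sum; the Fatou property gives the limit. *)
Lemma norm_le_sum_abs (I : finType) (x : I -> R -> \bar R) r :
  (forall i, L0 alpha (x i)) ->
  norm_le E (fun t => \sum_i rearr (x i) t)%E r ->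
  norm_le E (fun t => \sum_i `|x i t|)%E r.
Proof.
move=> mx xr.
have mabs i : measurable_fun D (abse \o x i).
  by apply: measurableT_comp => //; exact: mx.
pose s i n := nnsfun_approx (measurable_dom alpha) (mabs i) n.
have s_nd i n t : s i n t <= s i n.+1 t by apply/lefP/nd_nnsfun_approx.
have s_cvg i t : D t -> (s i n t)%:E @[n --> \oo] --> `|x i t|%E.
  by move=> Dt; apply: (cvg_nnsfun_approx (measurable_dom alpha) (mabs i) _ Dt) => y _;
    exact: abse_ge0.
have s_le i n t : D t -> ((s i n t)%:E <= `|x i t|)%E.
  move=> Dt; rewrite /s nnsfun_approxE; apply: le_approx => // y _.
  exact: abse_ge0.
pose f (n : nat) (t : R) : R := \sum_i s i n t * (t < n%:R)%R%:R.
have msum : L0 alpha (fun t => \sum_i `|x i t|)%E.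
  by apply: emeasurable_sum => i; exact: mabs.
apply: (@norm_le_fatou _ _ E (fun n => EFin \o f n) (fun t => \sum_i `|x i t|)%E r Efatou msum).
- move=> n t Dt; rewrite lee_fin; apply: sumr_ge0 => i _; exact: mulr_ge0.
- move=> n t Dt; rewrite lee_fin; apply: ler_sum => i _.
  apply: ler_pM => //; rewrite ler_nat; case: ltP => // tn.
  by rewrite (lt_le_trans tn) // ler_nat.
- move=> t Dt; have : (fun n => \sum_i (s i n t)%:E)%E @ \oo --> (\sum_i `|x i t|)%E.
    apply: cvg_nnesum => i _; last exact: s_cvg.
    by apply: nearW => n; rewrite lee_fin.
  apply: cvg_trans; apply: near_eq_cvg; near=> n.
  have tn : t < n%:R.
    by near: n; exact: (nbhs_infty_gtr t).
  by rewrite /f /= sumEFin; congr EFin; apply: eq_bigr => i _; rewrite tn mulr1.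
move=> n.
have [v vP] : exists v : seq R, uniq v /\ forall i t, s i n t \in v.
  have /choice[w wP] : forall i, exists v : seq R, range (s i n) = [set` v].
    by move=> i; apply/finite_seqP; exact: fimfunP.
  exists (undup (flatten [seq w i | i <- index_enum I])); rewrite undup_uniq.
  split=> // i t; rewrite mem_undup; apply/flatten_mapP; exists i.
    exact: mem_index_enum.
  have : range (s i n) (s i n t) by exists t.
  by rewrite wP.
case: vP => uv sv.
(* A cell of the common partition prescribes the value of every [s i n]; [J] indexes the choices of
   one value per [i]. *)
pose J := {ffun I -> 'I_(size v)}.
pose A (q : 'I_#|J|) := [set t | [/\ D t, t < n%:R &
  forall i, s i n t = nth 0 v (enum_val q i)]].
(* The maximum with 0 makes all coefficients nonnegative and changes nothing on nonempty cells,
   where the entry is a value of [s i n]. *)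
pose c i (q : 'I_#|J|) := Num.max 0 (nth 0 v (enum_val q i)).
have AE q : A q = D `&` [set` `]-oo, n%:R[] `&`
    \bigcap_(i in [set: I]) (s i n @^-1` [set nth 0 v (enum_val q i)]).
  apply/seteqP; split=> t; rewrite /A /= in_itv /=.
    by move=> [Dt tn st]; split=> // i _; exact: st.
  by move=> [[Dt tn] st]; split=> // i; exact: st.
have mA q : measurable (A q).
  rewrite AE; apply: measurableI.
    by apply: measurableI; [exact: measurable_dom|exact: measurable_itv].
  apply: fin_bigcap_measurable => [|i _]; first exact: finite_finset.
  by rewrite -[_ @^-1` _]setTI; apply: measurable_funP => //.
have AD q : A q `<=` D by move=> t [].
have tA : trivIset setT A.
  apply/trivIsetP => p q _ _ /eqP pq; apply/seteqP; split=> // t [[_ _ h1] [_ _ h2]].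
  apply: pq; apply: enum_val_inj; apply/ffunP => i; apply: val_inj => /=.
  by apply/eqP; rewrite -(nth_uniq 0 _ _ uv) ?ltn_ord // -h1 -h2.
have finA q : (mu (A q) < +oo)%E.
  apply: (@le_lt_trans _ _ (mu (dom n%:R%:E))); last first.
    by rewrite lebesgue_measure_dom ?ltry // lee_fin.
  apply: le_measure; rewrite ?inE; [exact: mA|exact: measurable_dom|].
  by move=> t [[t0 _] tn _]; split=> //; rewrite lte_fin.
have stepE i t : D t -> step A (c i) t = s i n t * (t < n%:R)%R%:R.
  move=> Dt; have [tn|tn] := ltP t n%:R; last first.
    by rewrite mulr0 step_out // => q [_]; rewrite ltNge tn.
  pose j : J := [ffun i => Ordinal (etrans (index_mem (s i n t) v) (sv i t))].
  have Aj : A (enum_rank j) t.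
    by split=> // k; rewrite enum_rankK ffunE /= nth_index.
  rewrite (step_in _ tA Aj) mulr1 /c; case: Aj => _ _ <-.
  by rewrite max_r.
have c0 i q : 0 <= c i q by rewrite le_max lexx.
have h : norm_le E (EFin \o step A (fun q => \sum_i c i q)) r.
  apply: (norm_le_step tA mA AD finA c0 mx) => // i l l0.
  apply: le_distribution_fun => //; first exact: step_L0.
  apply: ae_onW => t Dt; rewrite /= stepE //.
  apply: le_trans (s_le i n t Dt); rewrite lee_fin ger0_norm ?mulr_ge0 //.
  by rewrite ler_piMr //; case: (t < _).
apply: norm_le_ideal h; last first.
  apply: ae_onW => t Dt; rewrite /= -sum_step.
  by rewrite /f (eq_bigr _ (fun i _ => stepE i t Dt)).
apply: (eq_measurable_fun (EFin \o step A (fun q => \sum_i c i q))).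
  move=> t /set_mem Dt; rewrite /= -sum_step.
  by rewrite /f (eq_bigr _ (fun i _ => stepE i t Dt)).
exact: step_L0.
Unshelve. all: by end_near. Qed.

End Submajorization.

(** * Elements of the space: the decreasing cone and the norm of a sum *)

Section FunctionSpaceElements.
Context {R : realType} (alpha : \bar R) (E : banach_function_space alpha).
Local Notation D := (dom alpha).
Local Notation rearr := (rearrangement alpha).

Lemma bfs_norm_le (x y : E) :
  ae_on alpha (fun t => `|bfs_fun x t| <= `|bfs_fun y t|)%E -> `|x| <= `|y|.
Proof.
move=> xy; have [x' [xx' x'y]] := bfs_ideal (bfs_L0 x) xy.
by rewrite -(bfs_inj xx').
Qed.

Lemma bfs_norm_eq (x y : E) :
  ae_on alpha (fun t => `|bfs_fun x t| = `|bfs_fun y t|)%E -> `|x| = `|y|.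
Proof.
move=> xy; apply/le_anti/andP; split; apply: bfs_norm_le.
  by apply: ae_onS xy => t _ ->.
by apply: ae_onS xy => t _ ->.
Qed.

Lemma bfs_fun0 : aeq alpha (bfs_fun (0 : E)) (fun=> 0%E).
Proof.
have := bfs_scale 0 (0 : E); rewrite scale0r.
by apply: ae_onS => t _ ->; rewrite mul0e.
Qed.

Lemma bfs_sum (I : Type) (s : seq I) (x : I -> E) :
  aeq alpha (bfs_fun (\sum_(i <- s) x i)) (fun t => \sum_(i <- s) bfs_fun (x i) t)%E.
Proof.
elim: s => [|i s ih].
  by rewrite big_nil; apply: ae_onS bfs_fun0 => t _ ->; rewrite big_nil.
rewrite big_cons; apply: ae_onS2 (bfs_add (x i) (\sum_(j <- s) x j)) ih => t _ -> ->.
by rewrite big_cons.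
Qed.

Lemma bfs_abs (x : E) : exists w : E,
  aeq alpha (bfs_fun w) (fun t => `|bfs_fun x t|%E) /\ `|w| = `|x|.
Proof.
have mabs : L0 alpha (fun t => `|bfs_fun x t|%E).
  by apply: measurableT_comp => //; exact: bfs_L0.
have [|w [wx _]] := @bfs_ideal _ _ E _ x mabs.
  by apply: ae_onW => t _; rewrite abse_id.
exists w; split=> //; apply: bfs_norm_eq.
by apply: ae_onS wx => t _ ->; rewrite abse_id.
Qed.

(** The supremum of [f] over the points of [G] to the right of [t] is decreasing everywhere and
    equals [f] on [G], so [rearrangement_antitone] applies to it. Adjoining 0 keeps it nonnegative
    where no such point exists. *)
Lemma rearrangement_antitone_ae (f : R -> \bar R) (G : R -> Prop) :
  L0 alpha f -> ae_on alpha G ->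
  (forall t, D t -> G t -> (0 <= f t)%E) ->
  (forall s t, D s -> D t -> G s -> G t -> s <= t -> (f t <= f s)%E) ->
  aeq alpha (rearr f) f.
Proof.
move=> mf aG f0 fd.
pose g t := ereal_sup [set y | y = 0%E \/ exists s, [/\ D s, G s, t <= s & y = f s]].
have gf : aeq alpha g f.
  apply: ae_onS aG => t Dt Gt; apply/le_anti/andP; split.
    apply: ge_ereal_sup => _ [->|[s [Ds Gs ts ->]]]; first exact: f0.
    exact: fd.
  by apply: ereal_sup_ubound; right; exists t.
have gd s t : D s -> D t -> s <= t -> (g t <= g s)%E.
  move=> _ _ st; apply: ge_ereal_sup => _ [->|[u [Du Gu tu ->]]].
    by apply: ereal_sup_ubound; left.
  by apply: ereal_sup_ubound; right; exists u; split=> //; exact: le_trans tu.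
have g0 t : D t -> (0 <= g t)%E by move=> _; apply: ereal_sup_ubound; left.
have mg := antitone_L0 gd.
rewrite /rearrangement -(distribution_fun_aeq mg mf gf).
exact: aeq_trans (rearrangement_antitone g0 gd) gf.
Qed.

Lemma decreasing_cone_antitone (y : E) (g : R -> \bar R) :
  aeq alpha (bfs_fun y) g -> (forall t, D t -> (0 <= g t)%E) ->
  (forall s t, D s -> D t -> s <= t -> (g t <= g s)%E) ->
  decreasing_cone E y.
Proof.
move=> yg g0 gd; exists y; apply: aeq_sym.
apply: (@rearrangement_antitone_ae _ (fun t => bfs_fun y t = g t)) => //.
- exact: bfs_L0.
- by move=> t Dt ->; exact: g0.
- by move=> s t Ds Dt -> ->; exact: gd.
Qed.

Lemma decreasing_coneZ (a : R) (y : E) : 0 <= a ->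
  decreasing_cone E y -> decreasing_cone E (a *: y).
Proof.
move=> a0 [x yx].
apply: (@decreasing_cone_antitone _ (fun t => a%:E * rearr (bfs_fun x) t)%E).
- by apply: ae_onS2 (bfs_scale a y) yx => t _ -> ->.
- by move=> t _; rewrite mule_ge0 ?lee_fin ?rearrangement_ge0.
- by move=> s t _ _ st; rewrite lee_wpmul2l ?lee_fin // rearrangement_anti.
Qed.

(** The partial sums of the [|v m|] increase and have norm at most 2, so by the Fatou property their
    limit belongs to [E] and is finite a.e.; the terms of a convergent series tend to 0. *)
Lemma summable_ae_cvg0 (Efatou : fatou_property E) (v : nat -> E) :
  (forall m, `|v m| <= 2 ^- m) ->
  ae_on alpha (fun t => bfs_fun (v m) t @[m --> \oo] --> 0%E).
Proof.
move=> v2; have /choice[w wP] m := bfs_abs (v m).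
have wv m : aeq alpha (bfs_fun (w m)) (fun t => `|bfs_fun (v m) t|%E).
  by have [] := wP m.
pose S N := \sum_(0 <= m < N) w m.
pose f t := (\sum_(0 <= m <oo) `|bfs_fun (v m) t|)%E.
have SE N : aeq alpha (bfs_fun (S N)) (fun t => \sum_(0 <= m < N) `|bfs_fun (v m) t|)%E.
  apply: ae_onS2 (bfs_sum (index_iota 0 N) w) (ae_on_forall wv) => t _ -> h.
  by apply: eq_bigr => m _; exact: h.
have mf : L0 alpha f.
  apply: ge0_emeasurable_sum => // m _.
  by apply: measurableT_comp => //; exact: bfs_L0.
have [||||y [yf _ _]] := Efatou S f _ _ mf.
- by move=> n; apply: ae_onS (SE n) => t _ ->; exact: sume_ge0.
- exists 2 => N.
  have : `|S N| <= \sum_(0 <= m < N) (2 ^- m : R).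
    apply: le_trans (ler_norm_sum _ _ _) _; apply: ler_sum => m _.
    by have [_ ->] := wP m.
  move/le_trans; apply.
  have -> : \sum_(0 <= m < N) (2 ^- m : R) = 2 - 2 * 2 ^- N.
    elim: N => [|N ih]; first by rewrite big_nil expr0 invr1 mulr1 subrr.
    by rewrite big_nat_recr //= ih (expN2S N); ring.
  by rewrite gerBl mulr_ge0 // ltW // expN2_gt0.
- move=> n; apply: ae_onS2 (SE n) (SE n.+1) => t _ -> ->.
  by rewrite big_nat_recr //= leeDl.
- apply: ae_onS (ae_on_forall SE) => t _ St.
  rewrite (_ : (fun n => _) = (fun n => \sum_(0 <= m < n) `|bfs_fun (v m) t|)%E).
    exact: is_cvg_nneseries.
  by apply/funext => n; exact: St.
apply: ae_onS2 yf (bfs_fin y) => t _ -> ffin.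
have fty : (f t < +oo)%E by rewrite ltey_eq ffin.
have tail := nneseries_tail_cvg fty (fun k _ => abse_ge0 _).
apply/cvg_abse0P; apply: (squeeze_cvge _ (cvg_cst 0%E) tail).
apply: nearW => n; rewrite abse_ge0 /=.
have := @nneseries_lim_ge R (fun k => `|bfs_fun (v k) t|)%E xpredT n n.+1.
by rewrite big_nat1; apply.
Qed.

(** A rapidly convergent subsequence converges a.e. by [summable_ae_cvg0], so [z] is a.e. a
    pointwise limit of decreasing nonnegative functions. *)
Lemma decreasing_cone_closed (Efatou : fatou_property E) (a : nat -> E) (z : E) :
  (forall n, decreasing_cone E (a n)) -> a @ \oo --> z -> decreasing_cone E z.
Proof.
move=> /choice[x ax] /cvgrPdist_lt az.
have [j N|phi _ phiP] := @subseq_rec (fun j _ n => `|a n - z| <= 2 ^- j).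
  have [M _ MP] := az _ (expN2_gt0 j).
  exists (N.+1 + M)%N; rewrite leq_addr; split=> //.
  by rewrite distrC ltW //; apply: MP => /=; rewrite leq_addl.
have v0 := summable_ae_cvg0 Efatou phiP.
pose G t := (fun m => rearr (bfs_fun (x (phi m.+1))) t) @ \oo --> bfs_fun z t.
have aG : ae_on alpha G.
  have av m : aeq alpha (bfs_fun (a (phi m.+1)))
      (fun t => bfs_fun (a (phi m.+1) - z)%R t + bfs_fun z t)%E.
    by have := bfs_add (a (phi m.+1) - z) z; rewrite subrK.
  have rv : ae_on alpha (fun t => forall m, rearr (bfs_fun (x (phi m.+1))) t =
      bfs_fun (a (phi m.+1) - z)%R t + bfs_fun z t)%E.
    by apply: ae_on_forall => m; apply: ae_onS2 (av m) (ax (phi m.+1)) => t _ <- ->.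
  apply: ae_onS2 (rv) (ae_onS2 (fun t _ h1 h2 => conj h1 h2) v0 (bfs_fin z)) => t _ rt [vt zf].
  rewrite /G (_ : (fun m => _) = (fun m => bfs_fun (a (phi m.+1) - z)%R t + bfs_fun z t)%E).
    rewrite -[X in _ --> X]add0e; apply: (cvgeD _ vt (cvg_cst _)).
    by rewrite fin_num_adde_defl.
  by apply/funext => m; exact: rt.
exists z; apply: aeq_sym; apply: (rearrangement_antitone_ae (bfs_L0 z) aG).
  move=> t _ Gt; apply: cvge_ge Gt; apply: nearW => m; exact: rearrangement_ge0.
move=> s t _ _ Gs Gt st; apply: (lee_cvg_to Gt Gs).
by apply: nearW => m; exact: rearrangement_anti.
Qed.

Context (Esym : symmetric_space E).

Lemma symmetric_norm_eq (x y : E) :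
  distribution_fun alpha (bfs_fun x) = distribution_fun alpha (bfs_fun y) ->
  `|x| = `|y|.
Proof. by move=> /(Esym (bfs_L0 x))[z [/bfs_inj -> ->]]. Qed.

Lemma exists_rearrangement (x : E) : exists a : E,
  aeq alpha (bfs_fun a) (rearr (bfs_fun x)).
Proof.
have [a [ax _]] := Esym (@rearrangement_L0 R alpha (bfs_fun x))
  (distribution_fun_rearrangement (bfs_L0 x)).
by exists a.
Qed.

Lemma distribution_fun_aeq_rearrangement (x a : E) :
  aeq alpha (bfs_fun a) (rearr (bfs_fun x)) ->
  distribution_fun alpha (bfs_fun a) = distribution_fun alpha (bfs_fun x).
Proof.
move=> ax; rewrite -(distribution_fun_rearrangement (bfs_L0 x)).
by apply: distribution_fun_aeq => //; [exact: bfs_L0|exact: rearrangement_L0].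
Qed.

(** Pointwise the modulus of the sum is at most the sum of the moduli, which [norm_le_sum_abs]
    bounds. *)
Lemma norm_sum_rearrangement_le (Efatou : fatou_property E) (I : finType)
    (x a : I -> E) :
  (forall i, aeq alpha (bfs_fun (a i)) (rearr (bfs_fun (x i)))) ->
  `|\sum_i x i| <= `|\sum_i a i|.
Proof.
move=> ax.
have ax' : aeq alpha (bfs_fun (\sum_i a i)) (fun t => \sum_i rearr (bfs_fun (x i)) t)%E.
  elim: (index_enum I) => [|i s ih].
    by rewrite big_nil; apply: ae_onS bfs_fun0 => t _ ->; rewrite big_nil.
  rewrite big_cons; apply: ae_onS2 (bfs_add (a i) (\sum_(j <- s) a j)) (ae_onS2 (fun t _ h1 h2 => conj h1 h2) (ax i) ih)
    => t _ -> [-> ->].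
  by rewrite big_cons.
have [|y [yx ya]] := norm_le_sum_abs Esym Efatou (x := fun i => bfs_fun (x i))
  (r := `|\sum_i a i|) (fun i => bfs_L0 (x i)); first by exists (\sum_i a i).
apply: le_trans ya; apply: bfs_norm_le.
apply: ae_onS2 (bfs_sum (index_enum I) x) yx => t _ -> ->.
rewrite [leRHS]gee0_abs; last by apply: sume_ge0 => i _; exact: abse_ge0.
exact: lee_abs_sum.
Qed.

End FunctionSpaceElements.

Lemma cvg_sum_seq (R : realType) (V : normedModType R) (I : Type) (s : seq I)
    (f : I -> nat -> V) (l : I -> V) :
  (forall i, f i @ \oo --> l i) ->
  (fun n => \sum_(i <- s) f i n) @ \oo --> \sum_(i <- s) l i.
Proof.
move=> fl; elim: s => [|i s ih].
  by rewrite big_nil; under eq_fun do rewrite big_nil; exact: cvg_cst.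
by rewrite big_cons; under eq_fun do rewrite big_cons; exact: cvgD.
Qed.

(** * Linear identification of the two normed spaces *)

Section Renorming.
Context {R : realType} (alpha : \bar R) (E F : banach_function_space alpha).
Context (EF : equivalent_renorming E F).

(** Choosing for each [x] the element of [F] with the same function is linear, because functions
    determine elements up to a.e. equality. *)
Lemma renorming_map : exists iota : E -> F,
  [/\ (forall x, aeq alpha (bfs_fun (iota x)) (bfs_fun x)),
      {morph iota : x y / x + y},
      (forall a, {morph iota : x / a *: x}),
      (forall y, exists x, iota x = y) &
      exists c C : R, [/\ 0 < c, 0 < C &
        forall x, c * `|x| <= `|iota x| /\ `|iota x| <= C * `|x|]].
Proof.
case: EF => /choice[iota iotaP] FE [c [C [c0 C0 cC]]]; exists iota; split=> //.
- move=> x y; apply: bfs_inj; apply: aeq_trans (iotaP (x + y)) _.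
  apply: aeq_trans (bfs_add x y) _; apply: aeq_sym.
  apply: aeq_trans (bfs_add (iota x) (iota y)) _.
  by apply: ae_onS2 (iotaP x) (iotaP y) => t _ -> ->.
- move=> a x; apply: bfs_inj; apply: aeq_trans (iotaP (a *: x)) _.
  apply: aeq_trans (bfs_scale a x) _; apply: aeq_sym.
  apply: aeq_trans (bfs_scale a (iota x)) _.
  by apply: ae_onS (iotaP x) => t _ ->.
- move=> y; have [x xy] := FE y; exists x; apply: bfs_inj.
  exact: aeq_trans (iotaP x) xy.
- by exists c, C; split=> // x; exact: cC (aeq_sym (iotaP x)).
Qed.

End Renorming.

(** * Transfer of rotundity from the decreasing cone and the equivalent norm *)

Section Transfer.
Context {R : realType} (alpha : \bar R) (k : nat) (E : banach_function_space alpha).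
Context (Esym : symmetric_space E) (Efatou : fatou_property E).
Context (Edcfr : compactly_fully_rotund_on k (decreasing_cone E)).
Context (Edlur : locally_uniformly_rotund_on (decreasing_cone E)).

(** The condition on sums of [k] subsequences in [compactly_fully_rotund_on], isolated because it
    passes to subsequences. *)
Definition asymptotically_flat (X : normedModType R) (x : nat -> X) :=
  forall phi : 'I_k -> nat -> nat,
    (forall i, {homo phi i : m n / (m < n)%N}) ->
    (fun n => `|\sum_(i < k) x (phi i n)|) @ \oo --> (k%:R : R).

Lemma asymptotically_flat_subseq (X : normedModType R) (x : nat -> X) psi :
  {homo psi : m n / (m < n)%N} -> asymptotically_flat x ->
  asymptotically_flat (x \o psi).
Proof.
move=> hpsi h phi hphi; apply: (h (fun i => psi \o phi i)) => i m n mn /=.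
exact/hpsi/hphi.
Qed.

Context (st : E -> E).
Context (stP : forall x, aeq alpha (bfs_fun (st x)) (rearrangement alpha (bfs_fun x))).

Lemma st_cone x : decreasing_cone E (st x).
Proof. by exists x. Qed.

Lemma norm_st x : `|st x| = `|x|.
Proof. by apply: symmetric_norm_eq => //; exact: distribution_fun_aeq_rearrangement. Qed.

(** Norms of sums of rearrangements lie between those of the original sums and [k], so the
    rearrangements inherit flatness and rotundity of the cone applies. *)
Lemma st_subseq_cvg (x : nat -> E) : (forall n, `|x n| = 1) ->
  asymptotically_flat x ->
  exists2 psi : nat -> nat, {homo psi : m n / (m < n)%N} &
  exists z : E, st \o x \o psi @ \oo --> z.
Proof.
move=> x1 xflat; apply: (@precompact_range_subseq _ _ (st \o x)).
apply: Edcfr => [n|n|phi hphi]; [exact: st_cone|by rewrite /= norm_st|].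
apply: (squeeze_cvgr _ (xflat _ hphi) (cvg_cst _)); apply: nearW => n.
rewrite norm_sum_rearrangement_le //=.
apply: le_trans (ler_norm_sum _ _ _) _.
rewrite (eq_bigr (fun=> 1)) => [|i _]; last by rewrite /= norm_st.
by rewrite sumr_const card_ord.
Qed.

Lemma st_norm_limit (x : nat -> E) (z : E) : (forall n, `|x n| = 1) ->
  st \o x @ \oo --> z -> `|z| = 1.
Proof.
move=> x1 /cvg_norm; under eq_fun do rewrite /= norm_st x1.
by move=> /(cvg_lim (@norm_hausdorff _ _)) <-; rewrite lim_cst //; exact: norm_hausdorff.
Qed.

Lemma st_sum_cvg (x : nat -> E) (z : E) : (forall n, `|x n| = 1) ->
  asymptotically_flat x -> st \o x @ \oo --> z ->
  forall phi : 'I_k -> nat -> nat,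
    (forall i, {homo phi i : m n / (m < n)%N}) ->
  (fun n => st (\sum_(i < k) x (phi i n))) @ \oo --> z *+ k.
Proof.
move=> x1 xflat xz phi hphi.
pose S n := \sum_(i < k) x (phi i n).
pose w n := \sum_(i < k) st (x (phi i n)).
have S_cvg : (fun n => `|S n|) @ \oo --> (k%:R : R) by exact: xflat.
have w_cvg : w @ \oo --> z *+ k.
  rewrite (_ : z *+ k = \sum_(i < k) z); last by rewrite sumr_const card_ord.
  by apply: cvg_sum_seq => i; exact: (cvg_subseq (hphi i) xz).
have z1 : `|z| = 1 by exact: st_norm_limit xz.
have zk : `|z *+ k| = k%:R.
  by rewrite -scaler_nat normrZ z1 mulr1 normr_nat.
have z_cone : decreasing_cone E (z *+ k).
  rewrite -scaler_nat; apply: decreasing_coneZ => //.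
  by apply: (decreasing_cone_closed Efatou _ xz) => n; exact: st_cone.
have lowb n : 2 * `|S n| <= `|st (S n) + w n|.
  (* The [k + 1] functions are [S n], placed at [ord0], and the [x (phi j n)]; they add up to twice
     [S n]. *)
  pose x' (i : 'I_k.+1) := oapp (fun j => x (phi j n)) (S n) (unlift ord0 i).
  have := @norm_sum_rearrangement_le _ _ E Esym Efatou _ x' (st \o x') (fun i => stP _).
  have split1 (g : E -> E) : \sum_i g (x' i) = g (S n) + \sum_(j < k) g (x (phi j n)).
    rewrite big_ord_recl /x' unlift_none /=; congr (_ + _).
    by apply: eq_bigr => j _; rewrite liftK.
  rewrite (split1 st) (split1 id) -/(S n) -/(w n).
  by rewrite -mulr2n -scaler_nat normrZ normr_nat.
have sum_cvg : (fun n => `|st (S n) + z *+ k|) @ \oo --> (2 * k%:R : R).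
  have w0 : (fun n => `|w n - z *+ k|) @ \oo --> (0 : R).
    rewrite -[X in _ --> X](@normr0 _ E) -(subrr (z *+ k)).
    by apply: cvg_norm; apply: cvgB => //; exact: cvg_cst.
  (* The lower bound is [lowb] with [w n] replaced by its limit at the cost of the distance; the
     upper one is the triangle inequality. *)
  apply: (@squeeze_cvgr _ _ _ _ (fun n => 2 * `|S n| - `|w n - z *+ k|)
      (fun n => `|S n| + k%:R)).
  - apply: nearW => n; apply/andP; split.
      rewrite lerBlDr; apply: le_trans (lowb n) _.
      rewrite (_ : st (S n) + w n = (st (S n) + z *+ k) + (w n - z *+ k)).
        exact: ler_normD.
      by rewrite addrACA subrr addr0.
    by rewrite -(norm_st (S n)) -zk; exact: ler_normD.
  - rewrite -[X in _ --> X]subr0; apply: cvgB => //.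
    by apply: cvgM => //; exact: cvg_cst.
  - by rewrite mulr_natl mulr2n; apply: cvgD => //; exact: cvg_cst.
have := Edlur z_cone (fun n => st_cone (S n)).
rewrite zk => /(_ sum_cvg); under [X in X @ _ --> _]eq_fun do rewrite norm_st.
move=> /(_ S_cvg) /norm_cvg0 h.
have : (fun n => (st (S n) - z *+ k) + z *+ k) @ \oo --> 0 + z *+ k.
  by apply: cvgD h _; exact: cvg_cst.
by rewrite add0r; under eq_fun do rewrite subrK.
Qed.

Lemma renormed_subseq_cvg (F : banach_function_space alpha) (x : nat -> E) :
  symmetric_space F -> equivalent_renorming E F -> compactly_fully_rotund k F ->
  (forall n, `|x n| = 1) -> asymptotically_flat x ->
  exists2 psi : nat -> nat, {homo psi : m n / (m < n)%N} &
  exists z : E, x \o psi @ \oo --> z.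
Proof.
move=> Fsym EF Fcfr x1' xflat'.
have [psi hpsi [z xz]] := st_subseq_cvg x1' xflat'.
have xflat := asymptotically_flat_subseq hpsi xflat'.
move: xz xflat; set y := x \o psi => yz yflat.
have y1 n : `|y n| = 1 by exact: x1'.
have [iota [iotaP iotaD iotaZ iotaS [c [C [c0 C0 cC]]]]] := renorming_map EF.
(* By symmetry the norm of [F] does not distinguish [u] from its rearrangement, so convergence of
   rearrangements yields convergence of the norms in [F] of the functions themselves. *)
have iota_st u : `|iota (st u)| = `|iota u|.
  apply: symmetric_norm_eq => //.
  rewrite (distribution_fun_aeq (bfs_L0 _) (bfs_L0 _) (iotaP (st u))).
  rewrite (distribution_fun_aeq (bfs_L0 _) (bfs_L0 _) (iotaP u)).
  exact: distribution_fun_aeq_rearrangement.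
have iota0 : iota 0 = 0 by rewrite -(scale0r (0 : E)) iotaZ scale0r.
have iotaB u v : iota (u - v) = iota u - iota v.
  by rewrite iotaD -scaleN1r iotaZ scaleN1r.
have iota_sum (I : finType) (u : I -> E) : iota (\sum_i u i) = \sum_i iota (u i).
  exact: (big_morph iota iotaD iota0).
have iota_cvg (u : nat -> E) v : u @ \oo --> v -> iota \o u @ \oo --> iota v.
  move=> /cvgrPdist_lt uv; apply/cvgrPdist_lt => e e0.
  apply: filterS (uv (e / C) (divr_gt0 e0 C0)) => n un /=.
  rewrite -iotaB; apply: le_lt_trans (proj2 (cC _)) _.
  by rewrite mulrC -ltr_pdivlMr.
pose rho := `|iota z|; pose nu n := `|iota (y n)|.
have nu_cvg : nu @ \oo --> rho.
  have : (fun n => `|iota (st (y n))|) @ \oo --> rho.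
    by apply: cvg_norm; exact: iota_cvg yz.
  by under eq_fun do rewrite iota_st.
have rho0 : 0 < rho.
  have [h _] := cC z; apply: lt_le_trans h.
  by rewrite (st_norm_limit y1 yz) mulr1.
have nu0 n : 0 < nu n.
  by have [h _] := cC (y n); apply: lt_le_trans h; rewrite y1 mulr1.
pose X n := (nu n)^-1 *: iota (y n).
have X1 n : `|X n| = 1.
  by rewrite normrZ gtr0_norm ?invr_gt0 // mulVf // lt0r_neq0.
have Xflat : asymptotically_flat X.
  move=> phi hphi.
  (* In the sum of the normalised terms, [A n] has all factors replaced by their limit [rho^-1], and
     [B n] is the error. *)
  pose A n := rho^-1 *: \sum_(i < k) iota (y (phi i n)).
  pose B n := \sum_(i < k) ((nu (phi i n))^-1 - rho^-1) *: iota (y (phi i n)).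
  have A_cvg : (fun n => `|A n|) @ \oo --> (k%:R : R).
    have : (fun n => rho^-1 * `|iota (st (\sum_(i < k) y (phi i n)))|) @ \oo -->
        rho^-1 * `|iota (z *+ k)|.
      apply: cvgM; first exact: cvg_cst.
      apply: cvg_norm; apply: (iota_cvg (fun n => st (\sum_(i < k) y (phi i n)))).
      exact: (st_sum_cvg y1 yflat yz).
    rewrite -scaler_nat iotaZ normrZ normr_nat mulrCA mulVf ?lt0r_neq0 // mulr1.
    apply: cvg_trans; apply: near_eq_cvg; apply: nearW => n.
    by rewrite iota_st iota_sum /A normrZ gtr0_norm // invr_gt0.
  have B_cvg : (fun n => `|B n|) @ \oo --> (0 : R).
    rewrite -[X in _ --> X](@normr0 _ F); apply: cvg_norm.
    rewrite (_ : 0 = \sum_(i < k) 0 :> F); last by rewrite big1.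
    apply: cvg_sum_seq => i; apply: norm_cvg0.
    have : (fun n => `|(nu (phi i n))^-1 - rho^-1| * nu (phi i n)) @ \oo -->
        `|rho^-1 - rho^-1| * rho.
      have nuphi := cvg_subseq (hphi i) nu_cvg.
      apply: cvgM => //; apply: cvg_norm; apply: cvgB; last exact: cvg_cst.
      by apply: cvgV => //; rewrite lt0r_neq0.
    rewrite subrr normr0 mul0r; apply: cvg_trans; apply: near_eq_cvg.
    by apply: nearW => n; rewrite normrZ.
  have XE n : \sum_(i < k) X (phi i n) = A n + B n.
    rewrite /A /B scaler_sumr -big_split; apply: eq_bigr => i _ /=.
    by rewrite scalerBl addrC subrK.
  apply: (@squeeze_cvgr _ _ _ _ (fun n => `|A n| - `|B n|) (fun n => `|A n| + `|B n|)).
  - by apply: nearW => n; rewrite XE lerB_normD ler_normD.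
  - by rewrite -[X in _ --> X]subr0; exact: cvgB.
  - by rewrite -[X in _ --> X]addr0; exact: cvgD.
have [chi hchi [W XW]] := precompact_range_subseq (Fcfr X (fun=> I) X1 Xflat).
have [v vW] := iotaS (rho *: W).
exists (psi \o chi) => [m n mn|]; first exact/hpsi/hchi.
exists v; apply/cvgrPdist_lt => e e0.
(* Undoing the normalisation gives convergence in [F], and the lower norm estimate [c] brings it
   back to [E]. *)
have : (fun n => nu (chi n) *: X (chi n)) @ \oo --> rho *: W.
  by apply: cvgZ => //; exact: (cvg_subseq hchi nu_cvg).
move/cvgrPdist_lt => /(_ _ (mulr_gt0 c0 e0)); apply: filterS => n.
rewrite /X scalerA mulfV ?lt0r_neq0 // scale1r -vW -iotaB => h.
rewrite -(ltr_pM2l c0); apply: le_lt_trans h.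
by have [] := cC (v - y (chi n)).
Qed.

End Transfer.

Theorem theorem5p5 (R : realType) (alpha : \bar R)
    (halpha : alpha = 1%:E \/ alpha = +oo%E)
    (k : nat) (hk : (2 <= k)%N)
    (E : banach_function_space alpha)
    (Esym : symmetric_space E)
    (Efatou : fatou_property E)
    (Edcfr : compactly_fully_rotund_on k (decreasing_cone E))
    (Edlur : locally_uniformly_rotund_on (decreasing_cone E))
    (Eo : exists F : banach_function_space alpha,
        [/\ symmetric_space F,
            equivalent_renorming E F
          & compactly_fully_rotund k F]) :
  compactly_fully_rotund k E.
Proof.
move=> x _ x1 xflat; have /choice[st stP] := exists_rearrangement Esym.
(* It suffices that every subsequence of [x] has a convergent subsequence; it is again normalised
   and asymptotically flat. *)
case: Eo => F [Fsym EF Fcfr]; apply: subseq_precompact_range => phi hphi.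
apply: (renormed_subseq_cvg Esym Efatou Edcfr Edlur stP Fsym EF Fcfr).
  by move=> n; exact: x1.
exact: asymptotically_flat_subseq.
Qed.
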